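(* Let $\mathbb{X}\subseteq\mathbb{P}^2$ be a $\Bbbk$-configuration of type $(d_1,\dots,d_s)$ with $d_s>s$, and let $r$ be the number of lines in $\mathbb{P}^2$ containing exactly $d_s$ points of $\mathbb{X}$. Then $r=\Delta\mathbf{H}_{m\mathbb{X}}(md_s-1)$ for all integers $m\ge2$.
   Context: $\Bbbk$ is an algebraically closed field and $R=\Bbbk[x_0,x_1,x_2]$. A $\Bbbk$-configuration of type $(d_1,\dots,d_s)$ is a finite set $\mathbb{X}\subseteq\mathbb{P}^2$ for which there exist integers $1\le d_1<\cdots<d_s$, subsets $\mathbb{X}_1,\dots,\mathbb{X}_s$ of $\mathbb{X}$ and distinct lines $\mathbb{L}_1,\dots,\mathbb{L}_s\subseteq\mathbb{P}^2$ such that (1) $\mathbb{X}=\bigcup_{i=1}^s\mathbb{X}_i$; (2) $|\mathbb{X}_i|=d_i$ and $\mathbb{X}_i\subseteq\mathbb{L}_i$ for each $i$; (3) for $1<i\le s$, $\mathbb{L}_i$ contains no point of $\mathbb{X}_j$ for any $j<i$. For $\mathbb{X}=\{P_1,\dots,P_n\}$ and $m\ge1$, $m\mathbb{X}$ is the fat point scheme with ideal $I_{m\mathbb{X}}=I_{P_1}^m\cap\cdots\cap I_{P_n}^m$, where $I_P$ is the ideal of $P$. $\mathbf{H}_\mathbb{Z}(t)=\dim_\Bbbk R_t-\dim_\Bbbk(I_\mathbb{Z})_t$ and $\Delta\mathbf{H}_\mathbb{Z}(t)=\mathbf{H}_\mathbb{Z}(t)-\mathbf{H}_\mathbb{Z}(t-1)$,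 with $\mathbf{H}_\mathbb{Z}(t)=0$ for $t<0$. *)

(* Defs.v *)
From HB Require Import structures.
From mathcomp Require Import all_boot all_order all_algebra.
From Stdlib Require Import ClassicalEpsilon.
Set Implicit Arguments. Unset Strict Implicit. Unset Printing Implicit Defensive.
Import Order.TTheory GRing.Theory Num.Theory.
Local Open Scope ring_scope.

(* Homogeneous coordinates: a triple (a0,a1,a2); a point of P^2 (resp. a line
   of P^2, via l0 x0 + l1 x1 + l2 x2 = 0) is represented by a nonzero triple. *)
Definition pt (K : fieldType) := (K * K * K)%type.
Definition c0 {K : fieldType} (p : pt K) : K := p.1.1.
Definition c1 {K : fieldType} (p : pt K) : K := p.1.2.
Definition c2 {K : fieldType} (p : pt K) : K := p.2.

Definition nonzero_pt {K : fieldType} (p : pt K) : bool :=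
  [|| c0 p != 0, c1 p != 0 | c2 p != 0].

(* proportional triples (= same projective point / line, for nonzero triples) *)
Definition proj_eq {K : fieldType} (p q : pt K) : bool :=
  [&& c0 p * c1 q == c1 p * c0 q, c0 p * c2 q == c2 p * c0 q
    & c1 p * c2 q == c2 p * c1 q].

Definition on_line {K : fieldType} (l p : pt K) : bool :=
  c0 l * c0 p + c1 l * c1 p + c2 l * c2 p == 0.

Definition proj_list {K : fieldType} (s : seq (pt K)) : Prop :=
  (forall p, p \in s -> nonzero_pt p) /\
  (forall i j, (i < size s)%N -> (j < size s)%N -> i <> j ->
     ~~ proj_eq (nth (0,0,0) s i) (nth (0,0,0) s j)).

Definition kconfig {K : fieldType} (X : seq (pt K)) (ds : seq nat) : Prop :=
  proj_list X /\ ds <> [::] /\ (0 < head 0 ds)%N /\ sorted ltn ds /\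
  exists (Xs : seq (seq (pt K))) (Ls : seq (pt K)),
    [/\ size Xs = size ds, size Ls = size ds & proj_list Ls] /\
    [/\
       (forall i, (i < size ds)%N ->
          [/\ uniq (nth [::] Xs i), size (nth [::] Xs i) = nth 0%N ds i,
              {subset nth [::] Xs i <= X} &
              (forall p, p \in nth [::] Xs i -> on_line (nth (0,0,0) Ls i) p)]),
       (forall i j, (j < i)%N -> (i < size ds)%N ->
          forall p, p \in nth [::] Xs j -> ~~ on_line (nth (0,0,0) Ls i) p) &
       (forall p, p \in X -> exists2 i, (i < size ds)%N & p \in nth [::] Xs i)].

Definition lines_with_exactly {K : fieldType} (X : seq (pt K)) (d : nat)
    (Ls : seq (pt K)) : Prop :=
  proj_list Ls /\
  (forall l, l \in Ls -> count (on_line l) X = d) /\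
  (forall l, nonzero_pt l -> count (on_line l) X = d ->
     exists2 l', l' \in Ls & proj_eq l l').

(* R = k[x0,x1,x2], realised as ((k[x0])[x1])[x2]:
   x2 = 'X, x1 = 'X%:P, x0 = 'X%:P%:P. *)
Definition R3 (K : fieldType) := {poly {poly {poly K}}}.
Definition cst {K : fieldType} (c : K) : R3 K := (c%:P)%:P%:P.

Definition coef3 {K : fieldType} (F : R3 K) (i j k : nat) : K := F`_k`_j`_i.

Definition homog {K : fieldType} (t : nat) (F : R3 K) : Prop :=
  forall i j k, coef3 F i j k != 0 -> (i + j + k)%N = t.

Definition eval3 {K : fieldType} (F : R3 K) (p : pt K) : K :=
  ((F.[(c2 p)%:P%:P]).[(c1 p)%:P]).[c0 p].

(* I_P: the (homogeneous) ideal of the point P, i.e. the polynomials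
   vanishing on the affine cone over P *)
Definition I_pt {K : fieldType} (p : pt K) (F : R3 K) : Prop :=
  forall c : K, eval3 F (c * c0 p, c * c1 p, c * c2 p) = 0.

Definition ideal_pow {K : fieldType} (I : R3 K -> Prop) (m : nat) (F : R3 K) : Prop :=
  exists (n : nat) (g : 'I_n -> 'I_m -> R3 K) (h : 'I_n -> R3 K),
    (forall i j, I (g i j)) /\ F = \sum_(i < n) h i * \prod_(j < m) g i j.

Definition I_fat {K : fieldType} (X : seq (pt K)) (m : nat) (F : R3 K) : Prop :=
  forall p, p \in X -> ideal_pow (@I_pt K p) m F.

Definition lin_indep {K : fieldType} (r : nat) (f : 'I_r -> R3 K) : Prop :=
  forall c : 'I_r -> K, \sum_(i < r) cst (c i) * f i = 0 -> forall i, c i = 0.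

Definition has_dim {K : fieldType} (S : R3 K -> Prop) (d : nat) : Prop :=
  (exists f : 'I_d -> R3 K, (forall i, S (f i)) /\ lin_indep f) /\
  (forall f : 'I_d.+1 -> R3 K, (forall i, S (f i)) -> ~ lin_indep f).

Definition dimK {K : fieldType} (S : R3 K -> Prop) : nat :=
  epsilon (inhabits 0%N) (has_dim S).

Definition hilb {K : fieldType} (I : R3 K -> Prop) (t : nat) : int :=
  (dimK (@homog K t))%:Z - (dimK (fun F => homog t F /\ I F))%:Z.

Definition deltaH {K : fieldType} (I : R3 K -> Prop) (t : nat) : int :=
  hilb I t - (if t is t'.+1 then hilb I t' else 0).

(* Main.v *)
Require Import Defs.
From HB Require Import structures.
From mathcomp Require Import all_boot all_order all_algebra.
From mathcomp Require Import ring zify.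
From Stdlib Require Import ClassicalEpsilon.
Set Implicit Arguments. Unset Strict Implicit. Unset Printing Implicit Defensive.
Import Order.TTheory GRing.Theory Num.Theory.
Local Open Scope ring_scope.

(* Write d = d_s, n = |X|, and a_t, D_t for the dimensions in degree t of the ideal of
   mX and of R.  We show a_t = D_t - n C(m+1,2) for t = md-1, and
   a_t = D_t - n C(m+1,2) + r for t = md-2.

   Upper bounds: restricting forms of degree t to a line L and dividing those that
   vanish there by the equation of L gives
     dim I_Z(t) <= dim I_(Z:L)(t-1) + max(0, t+1 - deg(Z.L)).
   Peel off L_s, ..., L_1 in this order, m times.  In the k-th round (k = 0, ..., m-1)
   the line L_(s-c) meets the residual scheme in degree at most (m-k)d - c, because
   d_(s-c) <= d - c and it meets each of the c later blocks in at most one point,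
   already peeled.  In degree md-2 the only positive defects come from round 0, where
   each line containing d points of X contributes one.

   Lower bounds: vanishing to order m at n points is n C(m+1,2) linear conditions.  As
   d > s, the r lines with d points are among the L_i and each has a point of X on no
   other.  In degree md-2 one can drop, for each of them, the condition on the
   (m-1)-st derivative along the line at this point: the restriction to the line
   still has md-1 zeros, hence is zero. *)

(** * Evaluation morphisms out of the nested polynomial ring *)

HB.instance Definition _ (K : fieldType) :=
  GRing.RMorphism.copy (@cst K) (polyC \o (polyC \o polyC)).

Definition var0 {K : fieldType} : R3 K := 'X%:P%:P.
Definition var1 {K : fieldType} : R3 K := 'X%:P.
Definition var2 {K : fieldType} : R3 K := 'X.

Section Evaluation.
Variables (K : fieldType) (A : comNzRingType) (f : {rmorphism K -> A}).

Definition ev1 (a : A) : {poly K} -> A :=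
  horner_morph (fun x => mulrC a (f x)).
HB.instance Definition _ a := GRing.RMorphism.on (ev1 a).
Definition ev2 (a b : A) : {poly {poly K}} -> A :=
  horner_morph (fun x => mulrC b (ev1 a x)).
HB.instance Definition _ a b := GRing.RMorphism.on (ev2 a b).
Definition ev (a b c : A) : R3 K -> A :=
  horner_morph (fun x => mulrC c (ev2 a b x)).
HB.instance Definition _ a b c := GRing.RMorphism.on (ev a b c).

Lemma ev_cst a b c k : ev a b c (cst k) = f k.
Proof. by rewrite /ev /cst horner_morphC /= /ev2 horner_morphC /= /ev1 horner_morphC. Qed.
Lemma ev_var0 a b c : ev a b c var0 = a.
Proof. by rewrite /ev /var0 horner_morphC /= /ev2 horner_morphC /= /ev1 horner_morphX. Qed.
Lemma ev_var1 a b c : ev a b c var1 = b.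
Proof. by rewrite /ev /var1 horner_morphC /= /ev2 horner_morphX. Qed.
Lemma ev_var2 a b c : ev a b c var2 = c.
Proof. by rewrite /ev /var2 horner_morphX. Qed.
Definition evE := (ev_cst, ev_var0, ev_var1, ev_var2).
End Evaluation.

(** * Coefficients and monomial expansion in three variables *)

Section Monomials.
Variable K : fieldType.
Implicit Types F G : R3 K.

Lemma R3_rmorph_ext (A : nzRingType) (g h : {rmorphism R3 K -> A}) :
  (forall c, g (cst c) = h (cst c)) -> g var0 = h var0 -> g var1 = h var1 ->
  g var2 = h var2 -> g =1 h.
Proof.
move=> hc h0 h1 h2.
have e1 p : g p%:P%:P = h p%:P%:P.
  elim/poly_ind: p => [|p c IH]; first by rewrite !rmorph0.
  by rewrite !rmorphD !rmorphM IH hc h0.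
have e2 p : g p%:P = h p%:P.
  elim/poly_ind: p => [|p c IH]; first by rewrite !rmorph0.
  by rewrite !rmorphD !rmorphM IH e1 h1.
elim/poly_ind => [|p c IH]; first by rewrite !rmorph0.
by rewrite !rmorphD !rmorphM IH e2 h2.
Qed.

Definition mono (i j k : nat) : R3 K := var0 ^+ i * var1 ^+ j * var2 ^+ k.

Lemma coef3D F G i j k : coef3 (F + G) i j k = coef3 F i j k + coef3 G i j k.
Proof. by rewrite /coef3 !coefD. Qed.
Lemma coef3_0 i j k : coef3 (0 : R3 K) i j k = 0.
Proof. by rewrite /coef3 !coef0. Qed.
Lemma coef3Z c F i j k : coef3 (cst c * F) i j k = c * coef3 F i j k.
Proof. by rewrite /coef3 /cst !coefCM. Qed.
Lemma coef3_sum (I : Type) (r : seq I) (P : pred I) (E : I -> R3 K) i j k :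
  coef3 (\sum_(x <- r | P x) E x) i j k = \sum_(x <- r | P x) coef3 (E x) i j k.
Proof.
elim/big_rec2: _ => [|x a b _ <-]; first exact: coef3_0.
exact: coef3D.
Qed.
Lemma coef3_mono a b c i j k :
  coef3 (mono a b c) i j k = ([&& i == a, j == b & k == c])%:R.
Proof.
rewrite /coef3 /mono /var0 /var1 /var2 -!rmorphXn /= -rmorphM /= coefCM coefXn.
case: (k == c); last by rewrite mulr0 !coef0 !andbF.
rewrite mulr1 andbT coefCM coefXn.
case: (j == b); last by rewrite mulr0 !coef0 !andbF.
by rewrite mulr1 andbT coefXn.
Qed.

Lemma coef3_ext F G : (forall i j k, coef3 F i j k = coef3 G i j k) -> F = G.
Proof. by move=> h; apply/polyP=> k; apply/polyP=> j; apply/polyP=> i; apply: h. Qed.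

Lemma R3_expand F : exists N, F = \sum_(k < N) \sum_(j < N) \sum_(i < N)
   cst (coef3 F i j k) * mono i j k.
Proof.
pose sk (k : nat) := size F`_k; pose sj (k j : nat) := size F`_k`_j.
(* [N] exceeds every exponent, in any variable, that has a nonzero coefficient, so one bound serves
   all three sums. *)
pose N := maxn (size F) (\max_(k < size F) maxn (sk k) (\max_(j < sk k) sj k j)).
have big i j k : coef3 F i j k != 0 -> [&& (i < N)%N, (j < N)%N & (k < N)%N].
  rewrite /coef3 => h.
  have hk : (k < size F)%N.
    by rewrite ltnNge; apply: contra h => hk; rewrite (nth_default _ hk) !coef0.
  have hj : (j < sk k)%N.
    by rewrite ltnNge; apply: contra h => hj; rewrite (nth_default _ hj) coef0.
  have hi : (i < sj k j)%N.
    by rewrite ltnNge; apply: contra h => hi; rewrite (nth_default _ hi).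
  have A1 := @leq_bigmax _ (fun k : 'I_(size F) =>
    maxn (sk k) (\max_(j < sk k) sj k j)) (Ordinal hk).
  have A2 := @leq_bigmax _ (fun j : 'I_(sk k) => sj k j) (Ordinal hj).
  have A3 : (maxn (sk k) (\max_(j < sk k) sj k j) <= N)%N.
    exact: leq_trans A1 (leq_maxr _ _).
  rewrite (leq_trans hk (leq_maxl _ _)) andbT; apply/andP; split.
    apply: leq_trans hi _; apply: leq_trans A3; apply: leq_trans A2 _.
    exact: leq_maxr.
  by apply: (leq_trans hj); apply: leq_trans A3; apply: leq_maxl.
exists N; apply: coef3_ext => i j k.
rewrite coef3_sum; under eq_bigr do rewrite coef3_sum.
under eq_bigr do under eq_bigr do rewrite coef3_sum.
under eq_bigr do under eq_bigr do under eq_bigr do rewrite coef3Z coef3_mono.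
case: (eqVneq (coef3 F i j k) 0) => [h0|/big/and3P [hi hj hk]].
  rewrite h0; symmetry; apply: big1 => c _; apply: big1 => b _; apply: big1 => a _.
  case: eqP => [ea|_]; last by rewrite mulr0.
  case: eqP => [eb|_]; last by rewrite mulr0.
  case: eqP => [ec|_]; last by rewrite mulr0.
  by rewrite -ea -eb -ec h0 mul0r.
rewrite (bigD1 (Ordinal hk)) //= (bigD1 (Ordinal hj)) //= (bigD1 (Ordinal hi)) //=.
rewrite !eqxx mulr1 !big1 ?addr0 //.
- move=> c /negPf; rewrite -val_eqE /= eq_sym => hc.
  by apply: big1 => b _; apply: big1 => a _; rewrite hc !andbF mulr0.
- move=> b /negPf; rewrite -val_eqE /= eq_sym => hc.
  by apply: big1 => a _; rewrite hc andbF mulr0.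
- by move=> a /negPf; rewrite -val_eqE /= eq_sym => ->; rewrite mulr0.
Qed.

Lemma R3_mono_ind (P : R3 K -> Prop) :
  P 0 -> (forall F G, P F -> P G -> P (F + G)) ->
  (forall c i j k, P (cst c * mono i j k)) -> forall F, P F.
Proof.
move=> p0 pD pm F; have [N ->] := R3_expand F.
by do 3![apply: (big_ind P) => // ? _].
Qed.

Lemma eval3_ev F p : eval3 F p = ev idfun (c0 p) (c1 p) (c2 p) F.
Proof.
(* As a composite of ring morphisms, iterated evaluation is determined by its values on the
   constants and the three variables. *)
pose g : R3 K -> K := horner_eval (c0 p) \o (horner_eval (c1 p)%:P
   \o horner_eval (c2 p)%:P%:P).
have -> : eval3 F p = g F by [].
apply: R3_rmorph_ext => [c|||]; rewrite /g /= /horner_eval ?evE //=.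
- by rewrite /cst !hornerC.
- by rewrite /var0 !hornerC hornerX.
- by rewrite /var1 !hornerC hornerX hornerC.
- by rewrite /var2 hornerX !hornerC.
Qed.
End Monomials.

(* An interface to k[x0,x1,x2] that hides the nested representation R3: with
   the latter exposed, unification of ring structures becomes intractable. *)
Record poly3 (K : fieldType) := Poly3 {
  ring3 :> idomainType;
  cst3 : {rmorphism K -> ring3};
  x0 : ring3; x1 : ring3; x2 : ring3;
  coefs : ring3 -> nat -> nat -> nat -> K;
  eval : forall A : comNzRingType, {rmorphism K -> A} -> A -> A -> A ->
    {rmorphism ring3 -> A};
  mon := fun i j k => x0 ^+ i * x1 ^+ j * x2 ^+ k;
  eval_cst : forall A f a b c k, @eval A f a b c (cst3 k) = f k;
  eval_x0 : forall A f a b c, @eval A f a b c x0 = a;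
  eval_x1 : forall A f a b c, @eval A f a b c x1 = b;
  eval_x2 : forall A f a b c, @eval A f a b c x2 = c;
  rmorph3_ext : forall (A : comNzRingType) (g h : {rmorphism ring3 -> A}),
    (forall c, g (cst3 c) = h (cst3 c)) -> g x0 = h x0 -> g x1 = h x1 ->
    g x2 = h x2 -> g =1 h;
  coefsD : forall F G i j k, coefs (F + G) i j k = coefs F i j k + coefs G i j k;
  coefsZ : forall c F i j k, coefs (cst3 c * F) i j k = c * coefs F i j k;
  coefs_mon : forall a b c i j k,
    coefs (mon a b c) i j k = ([&& i == a, j == b & k == c])%:R;
  coefs_ext : forall F G, (forall i j k, coefs F i j k = coefs G i j k) -> F = G;
  mon_ind : forall S : ring3 -> Prop, S 0 -> (forall F G, S F -> S G -> S (F + G)) ->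
    (forall c i j k, S (cst3 c * mon i j k)) -> forall F, S F }.

Definition R3_poly3 (K : fieldType) : poly3 K :=
  @Poly3 K {poly {poly {poly K}}} (@cst K) var0 var1 var2 coef3
   (fun A f a b c => ev f a b c) (@ev_cst K) (@ev_var0 K) (@ev_var1 K)
   (@ev_var2 K) (@R3_rmorph_ext K) (@coef3D K) (@coef3Z K) (@coef3_mono K)
   (@coef3_ext K) (@R3_mono_ind K).

(** * Bases of K^3 and their dual bases *)

Section Coordinates.
Variable K : fieldType.
Implicit Types p q l x : pt K.

Definition dot l p : K := c0 l * c0 p + c1 l * c1 p + c2 l * c2 p.
Definition cross p q : pt K :=
  (c1 p * c2 q - c2 p * c1 q, c2 p * c0 q - c0 p * c2 q, c0 p * c1 q - c1 p * c0 q).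
Definition pcomb (a : K) p (b : K) q : pt K :=
  (a * c0 p + b * c0 q, a * c1 p + b * c1 q, a * c2 p + b * c2 q).

Lemma pt_ext p q : c0 p = c0 q -> c1 p = c1 q -> c2 p = c2 q -> p = q.
Proof. by case: p => [[? ?] ?]; case: q => [[? ?] ?]; rewrite /c0 /c1 /c2 /= => -> -> ->. Qed.

Lemma c0_pcomb a p b q : c0 (pcomb a p b q) = a * c0 p + b * c0 q. Proof. by []. Qed.
Lemma c1_pcomb a p b q : c1 (pcomb a p b q) = a * c1 p + b * c1 q. Proof. by []. Qed.
Lemma c2_pcomb a p b q : c2 (pcomb a p b q) = a * c2 p + b * c2 q. Proof. by []. Qed.

Lemma dot_pcomb l a p b q : dot l (pcomb a p b q) = a * dot l p + b * dot l q.
Proof. by rewrite /dot /pcomb /c0 /c1 /c2 /=; ring. Qed.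

(* A basis (fp, fq, fw) of K^3 together with its dual basis (fa, fb, fc). *)
Record frame := Frame {
  fp : pt K; fq : pt K; fw : pt K; fa : pt K; fb : pt K; fc : pt K;
  frame_decomp : forall x,
    x = pcomb 1 (pcomb (dot fa x) fp (dot fb x) fq) (dot fc x) fw;
  frame_bp : dot fb fp = 0; frame_cp : dot fc fp = 0; frame_cq : dot fc fq = 0;
  frame_cw : dot fc fw = 1; frame_ap : dot fa fp = 1; frame_aq : dot fa fq = 0;
  frame_bq : dot fb fq = 1 }.

Lemma frame_ex p q : ~~ proj_eq p q -> exists A : frame, fp A = p /\ fq A = q.
Proof.
move=> npq; have [w dn0] : exists w, dot (cross p q) w != 0.
  case: (eqVneq (c0 (cross p q)) 0) => [z0|n0]; last first.
    by exists (1, 0, 0); move: n0; rewrite /dot /= /c0 /c1 /c2 /= mulr1 !mulr0 !addr0.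
  case: (eqVneq (c1 (cross p q)) 0) => [z1|n0]; last first.
    by exists (0, 1, 0); move: n0; rewrite /dot /= /c0 /c1 /c2 /= mulr1 !mulr0 add0r addr0.
  exists (0, 0, 1); apply: contraNneq npq => z2; move: z0 z1 z2.
  rewrite /proj_eq /dot /cross /c0 /c1 /c2 /= => z0 z1 z2.
  apply/and3P; split; rewrite -subr_eq0; apply/eqP.
  - by rewrite -[RHS]z2; ring.
  - by rewrite -[RHS]oppr0 -[in RHS]z1; ring.
  - by rewrite -[RHS]z0; ring.
(* Cramer's rule: [D] is the determinant of [p], [q], [w], and the dual basis consists of their
   pairwise cross products divided by [D]. *)
pose D := dot (cross p q) w.
pose sc (v : pt K) : pt K := (c0 v / D, c1 v / D, c2 v / D).
have dD : D != 0 by [].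
suff H : exists A : frame, [/\ fp A = p, fq A = q, fw A = w, fa A = sc (cross q w)
      & fb A = sc (cross w p) /\ fc A = sc (cross p q)].
  by case: H => A [? ? _ _ _]; exists A.
have e1 : forall x, x = pcomb 1 (pcomb (dot (sc (cross q w)) x) p
   (dot (sc (cross w p)) x) q) (dot (sc (cross p q)) x) w.
  move=> x; apply: pt_ext; move: dD;
  by rewrite /sc /D /dot /cross /pcomb /c0 /c1 /c2 /= => dD; field.
unshelve eexists (@Frame p q w (sc (cross q w)) (sc (cross w p)) (sc (cross p q)) e1
   _ _ _ _ _ _ _); try by [].
all: by move: dD; rewrite /sc /D /dot /cross /pcomb /c0 /c1 /c2 /= => dD; field.
Qed.

Lemma frame_c0 (A : frame) x : c0 x = c0 (fp A) * dot (fa A) x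
  + c0 (fq A) * dot (fb A) x + c0 (fw A) * dot (fc A) x.
Proof. by rewrite {1}(frame_decomp A x) !c0_pcomb; ring. Qed.
Lemma frame_c1 (A : frame) x : c1 x = c1 (fp A) * dot (fa A) x
  + c1 (fq A) * dot (fb A) x + c1 (fw A) * dot (fc A) x.
Proof. by rewrite {1}(frame_decomp A x) !c1_pcomb; ring. Qed.
Lemma frame_c2 (A : frame) x : c2 x = c2 (fp A) * dot (fa A) x
  + c2 (fq A) * dot (fb A) x + c2 (fw A) * dot (fc A) x.
Proof. by rewrite {1}(frame_decomp A x) !c2_pcomb; ring. Qed.
Lemma dot100 l : dot l (1, 0, 0) = c0 l.
Proof. by rewrite /dot /c0 /c1 /c2 /= mulr1 !mulr0 !addr0. Qed.
Lemma dot010 l : dot l (0, 1, 0) = c1 l.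
Proof. by rewrite /dot /c0 /c1 /c2 /= mulr1 !mulr0 add0r addr0. Qed.
Lemma dot001 l : dot l (0, 0, 1) = c2 l.
Proof. by rewrite /dot /c0 /c1 /c2 /= mulr1 !mulr0 !add0r. Qed.
Lemma frame_fc_neq0 (A : frame) : nonzero_pt (fc A).
Proof.
apply/negPn/negP => z; have := frame_cw A; move: z.
rewrite /nonzero_pt /dot !negb_or !negbK => /and3P [/eqP -> /eqP -> /eqP ->].
by rewrite !mul0r !addr0 => /esym/eqP; rewrite oner_eq0.
Qed.
End Coordinates.

(** * Homogeneous forms and linear forms *)

Section Evaluation3.
Variables (K : fieldType) (P : poly3 K).
Implicit Types F G : P.

Definition evalE := (@eval_cst K P, @eval_x0 K P, @eval_x1 K P, @eval_x2 K P).

Lemma eval_comp (A B : comNzRingType) (f : {rmorphism K -> A})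
    (f' : {rmorphism K -> B}) (g : {rmorphism A -> B}) a b c F :
  (forall k, g (f k) = f' k) ->
  g (eval P f a b c F) = eval P f' (g a) (g b) (g c) F.
Proof.
move=> gf; apply: (rmorph3_ext (g := g \o eval P f a b c)) => [k|||] /=;
by rewrite ?evalE.
Qed.

Lemma eval_id F : eval P (cst3 P) (x0 P) (x1 P) (x2 P) F = F.
Proof. by apply: (rmorph3_ext (h := idfun)) => [k|||]; rewrite ?evalE. Qed.

Lemma eval_mon (A : comNzRingType) (f : {rmorphism K -> A}) a b c i j k :
  eval P f a b c (mon P i j k) = a ^+ i * b ^+ j * c ^+ k.
Proof. by rewrite /mon !rmorphM !rmorphXn /= !evalE. Qed.

Lemma coefs0 i j k : coefs (0 : P) i j k = 0.
Proof. by rewrite -(mul0r 0) -{1}(rmorph0 (cst3 P)) coefsZ mul0r. Qed.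

Lemma coefs_sum (I : Type) (r : seq I) (Q : pred I) (E : I -> P) i j k :
  coefs (\sum_(x <- r | Q x) E x) i j k = \sum_(x <- r | Q x) coefs (E x) i j k.
Proof.
elim/big_rec2: _ => [|x a b _ <-]; first exact: coefs0.
exact: coefsD.
Qed.

Definition homog3 t F : Prop := forall i j k, coefs F i j k != 0 -> (i + j + k)%N = t.

(** The substitution (x0 T, x1 T, x2 T): the coefficient of T^n is the homogeneous component of
    degree n, so homogeneity becomes an identity that ring morphisms transport. *)
Definition eval_rad : {rmorphism P -> {poly P}} :=
  eval P (polyC \o cst3 P) ((x0 P)%:P * 'X) ((x1 P)%:P * 'X) ((x2 P)%:P * 'X).

Lemma eval_rad_coef F n i j k :
  coefs (eval_rad F)`_n i j k = if (i + j + k == n)%N then coefs F i j k else 0.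
Proof.
elim/mon_ind: F => [|F G hF hG|c a b d].
- by rewrite rmorph0 coef0 coefs0 if_same.
- by rewrite rmorphD coefD !coefsD hF hG; case: ifP => //; rewrite addr0.
have -> : eval_rad (cst3 P c * mon P a b d) = (cst3 P c * mon P a b d)%:P * 'X^(a + b + d).
  rewrite /eval_rad rmorphM eval_cst eval_mon /= /mon !exprMn !exprD.
  rewrite !rmorphM !rmorphXn /=; ring.
rewrite coefCM coefXn; case: eqP => [->|h].
  rewrite mulr1 coefsZ coefs_mon.
  case: and3P => [[/eqP -> /eqP -> /eqP ->]|_]; first by rewrite eqxx.
  by rewrite mulr0 if_same.
rewrite mulr0 coefs0 coefsZ coefs_mon.
case: and3P => [[/eqP -> /eqP -> /eqP ->]|_]; last by rewrite mulr0 if_same.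
by case: eqP => // h'; case: h.
Qed.

Lemma homog3P t F : homog3 t F <-> eval_rad F = F%:P * 'X^t.
Proof.
split=> [h|h].
  apply/polyP=> n; apply: coefs_ext => i j k; rewrite eval_rad_coef coefCM coefXn.
  case: (eqVneq (coefs F i j k) 0) => [h0|/h <-].
    by rewrite h0 if_same; case: eqP; rewrite ?mulr1 ?mulr0 ?coefs0.
  by rewrite eq_sym; case: eqP; rewrite ?mulr1 ?mulr0 ?coefs0.
move=> i j k h0; have := eval_rad_coef F t i j k.
have -> : (eval_rad F)`_t = F by rewrite h coefCM coefXn eqxx mulr1.
by case: eqP => // _ h1; rewrite h1 eqxx in h0.
Qed.

Lemma homog3D t F G : homog3 t F -> homog3 t G -> homog3 t (F + G).
Proof. by move=> /homog3P hF /homog3P hG; apply/homog3P; rewrite !rmorphD hF hG mulrDl. Qed.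
Lemma homog3_0 t : homog3 t (0 : P).
Proof. by move=> i j k; rewrite coefs0 eqxx. Qed.
Lemma homog3Z t c F : homog3 t F -> homog3 t (cst3 P c * F).
Proof.
by move=> /homog3P hF; apply/homog3P; rewrite !rmorphM hF /= /eval_rad eval_cst mulrA.
Qed.
Lemma homog3_mon i j k : homog3 (i + j + k) (mon P i j k).
Proof.
move=> a b c; rewrite coefs_mon.
by case: and3P => [[/eqP -> /eqP -> /eqP ->]|]; rewrite ?eqxx.
Qed.

Lemma homog3_divr t F G : homog3 t.+1 (F * G) -> homog3 1 G -> G != 0 -> homog3 t F.
Proof.
move=> /homog3P + /homog3P hG G0; rewrite rmorphM hG => h; apply/homog3P.
have nz : G%:P * 'X != 0 :> {poly P} by rewrite mulf_neq0 ?polyC_eq0 ?polyX_eq0.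
by apply: (mulIf nz); move: h; rewrite expr1 => ->; rewrite rmorphM /= exprS; ring.
Qed.

Lemma coefs_homog t F i j k : homog3 t F -> (i + j + k)%N != t -> coefs F i j k = 0.
Proof. by move=> h; apply: contra_neq_eq => /h. Qed.

Lemma eval_homog (A : comNzRingType) (f : {rmorphism K -> A})
    t F a b c x : homog3 t F ->
  eval P f (a * x) (b * x) (c * x) F = eval P f a b c F * x ^+ t.
Proof.
move=> /homog3P hF.
(* Specialising T to [x] in F(x0 T, x1 T, x2 T) = F T^t yields the scaling rule. *)
pose g : {rmorphism {poly P} -> A} := horner_morph (fun y => mulrC x (eval P f a b c y)).
have gC y : g y%:P = eval P f a b c y by exact: horner_morphC.
have gX : g 'X = x by exact: horner_morphX.
have gv v : g (v%:P * 'X) = eval P f a b c v * x by rewrite rmorphM gC gX.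
have := congr1 g hF; rewrite rmorphM rmorphXn gC gX => <-.
rewrite /eval_rad (eval_comp (f' := f)) => [|k]; last by rewrite /= gC eval_cst.
by rewrite !gv !evalE.
Qed.

Definition lin (l : pt K) : P :=
  cst3 P (c0 l) * x0 P + cst3 P (c1 l) * x1 P + cst3 P (c2 l) * x2 P.

Lemma eval_lin (A : comNzRingType) (f : {rmorphism K -> A}) a b c l :
  eval P f a b c (lin l) = f (c0 l) * a + f (c1 l) * b + f (c2 l) * c.
Proof. by rewrite /lin !rmorphD !rmorphM /= !evalE. Qed.

Lemma eval_lin3 (A : comNzRingType) (f : {rmorphism K -> A}) a b c (x y z : K) :
  eval P f a b c (lin (x, y, z)) = f x * a + f y * b + f z * c.
Proof. exact: eval_lin. Qed.

Lemma homog_lin l : homog3 1 (lin l).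
Proof.
apply/homog3P; rewrite /eval_rad eval_lin /= /lin !rmorphD !rmorphM /=; ring.
Qed.

Lemma lin_neq0 l : nonzero_pt l -> lin l != 0.
Proof.
apply: contraTneq => l0.
have := eval_lin idfun 1 0 0 l; have := eval_lin idfun 0 1 0 l.
have := eval_lin idfun 0 0 1 l.
rewrite l0 !rmorph0 /= !mulr0 !mulr1 ?addr0 ?add0r /nonzero_pt => <- <- <-.
by rewrite eqxx.
Qed.

(** The pairs are exponents of x1 and x2. With n = t+1 they index the monomials of degree t; with n
    = m, the conditions for vanishing to order m at a point. *)
Definition tri_idx n := {x : 'I_n * 'I_n | (x.1 + x.2 < n)%N}.

Lemma homog_expand t F : homog3 t F -> F = \sum_(x : tri_idx t.+1)
  cst3 P (coefs F (t - (val x).1 - (val x).2) (val x).1 (val x).2)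
    * mon P (t - (val x).1 - (val x).2) (val x).1 (val x).2.
Proof.
move=> hF; apply: coefs_ext => i j k; rewrite coefs_sum.
under eq_bigr do rewrite coefsZ coefs_mon.
case: (eqVneq (i + j + k)%N t) => [et|nt].
  have hjk : ((inord j : 'I_t.+1) + (inord k : 'I_t.+1) < t.+1)%N.
    by rewrite !inordK; lia.
  rewrite (bigD1 (exist _ (inord j, inord k) hjk)) //= !inordK; try lia.
  have -> : (t - j - k)%N = i by lia.
  rewrite !eqxx mulr1 big1 ?addr0 // => x nx.
  case: and3P => [[/eqP _ /eqP ej /eqP ek]|_]; last by rewrite mulr0.
  case/negP: nx; rewrite -val_eqE /=; apply/eqP.
  by case: (val x) ej ek => a b /= -> ->; rewrite !inord_val.
rewrite (coefs_homog hF nt) big1 // => x _.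
case: and3P => [[/eqP ei /eqP ej /eqP ek]|_]; last by rewrite mulr0.
by case/eqP: nt; have := valP x; move: ei ej ek; rewrite /=; lia.
Qed.

Lemma homog_factor_x2 t F : homog3 t F -> (forall i j, coefs F i j 0 = 0) ->
  exists G, F = G * x2 P.
Proof.
move=> hF h0; rewrite (homog_expand hF).
elim/big_ind: _ => [|_ _ [G ->] [H ->]|x _].
- by exists 0; rewrite mul0r.
- by exists (G + H); rewrite mulrDl.
case: (val x).2 => [[|k] hk] /=; first by exists 0; rewrite h0 rmorph0 !mul0r.
by eexists; rewrite /mon exprSr !mulrA.
Qed.
End Evaluation3.

(** * Linear changes of coordinates and restriction to a line *)

Section Chart.
Variables (K : fieldType) (P : poly3 K) (A : frame K).
Implicit Types F G : P.

(** F written in the basis of the frame: [fp] becomes (1:0:0), and the line through [fp] and [fq]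
    becomes x2 = 0. *)
Definition chart : {rmorphism P -> P} := eval P (cst3 P)
  (lin P (c0 (fp A), c0 (fq A), c0 (fw A))) (lin P (c1 (fp A), c1 (fq A), c1 (fw A)))
  (lin P (c2 (fp A), c2 (fq A), c2 (fw A))).
Definition unchart : {rmorphism P -> P} :=
  eval P (cst3 P) (lin P (fa A)) (lin P (fb A)) (lin P (fc A)).

Lemma chartK : cancel chart unchart.
Proof.
move=> F; rewrite /chart (eval_comp (f' := cst3 P)); last by move=> k; exact: eval_cst.
rewrite /unchart !eval_lin3.
(* The composite substitution is the product of the matrices of the frame and its dual; the entries
   are read off by decomposing the standard basis vectors. *)
have col (c : pt K -> K) (u v w : K) :
   c (fp A) * c0 (fa A) + c (fq A) * c0 (fb A) + c (fw A) * c0 (fc A) = u ->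
   c (fp A) * c1 (fa A) + c (fq A) * c1 (fb A) + c (fw A) * c1 (fc A) = v ->
   c (fp A) * c2 (fa A) + c (fq A) * c2 (fb A) + c (fw A) * c2 (fc A) = w ->
   cst3 P (c (fp A)) * lin P (fa A) + cst3 P (c (fq A)) * lin P (fb A)
   + cst3 P (c (fw A)) * lin P (fc A) = cst3 P u * x0 P + cst3 P v * x1 P + cst3 P w * x2 P.
  by move=> <- <- <-; rewrite /lin !rmorphD !rmorphM /=; ring.
have u0 := frame_c0 A (1, 0, 0); have v0 := frame_c0 A (0, 1, 0).
have w0 := frame_c0 A (0, 0, 1); rewrite !dot100 in u0; rewrite !dot010 in v0.
rewrite !dot001 in w0; rewrite (col c0 1 0 0 (esym u0) (esym v0) (esym w0)).
have u1 := frame_c1 A (1, 0, 0); have v1 := frame_c1 A (0, 1, 0).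
have w1 := frame_c1 A (0, 0, 1); rewrite !dot100 in u1; rewrite !dot010 in v1.
rewrite !dot001 in w1; rewrite (col c1 0 1 0 (esym u1) (esym v1) (esym w1)).
have u2 := frame_c2 A (1, 0, 0); have v2 := frame_c2 A (0, 1, 0).
have w2 := frame_c2 A (0, 0, 1); rewrite !dot100 in u2; rewrite !dot010 in v2.
rewrite !dot001 in w2; rewrite (col c2 0 0 1 (esym u2) (esym v2) (esym w2)).
by rewrite !rmorph0 !rmorph1 !mul0r !mul1r !addr0 !add0r eval_id.
Qed.

Lemma chart_homog t F : homog3 t F -> homog3 t (chart F).
Proof.
move=> hF; apply/homog3P; rewrite /chart /eval_rad.
rewrite (eval_comp (f' := polyC \o cst3 P)) /=; last by move=> k; exact: eval_cst.
rewrite (eval_comp (f' := polyC \o cst3 P) (g := polyC)) // -eval_homog //.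
by congr (eval _ _ _ _ _ _); rewrite eval_lin /= /lin !rmorphD !rmorphM /=; ring.
Qed.

(** Restriction to the line through [p] and [q], parametrised as p + T q; the point [q] is at
    infinity. *)
Definition line_poly (p q : pt K) : {rmorphism P -> {poly K}} := eval P polyC
  ((c0 p)%:P + (c0 q)%:P * 'X) ((c1 p)%:P + (c1 q)%:P * 'X) ((c2 p)%:P + (c2 q)%:P * 'X).

Lemma line_poly_chart F : line_poly (fp A) (fq A) F = eval P polyC 1 'X 0 (chart F).
Proof.
rewrite /chart (eval_comp (f' := polyC)) /=; last by move=> k; exact: eval_cst.
by congr (eval _ _ _ _ _ _); rewrite eval_lin /=; ring.
Qed.

(** In the chart the line is (1, T, 0), so only monomials without x2 survive, and the one with x1^j
    gives T^j. *)
Lemma line_poly_coef t F j : homog3 t F ->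
  (line_poly (fp A) (fq A) F)`_j =
  if (j <= t)%N then coefs (chart F) (t - j) j 0 else 0.
Proof.
move=> hF; rewrite line_poly_chart {1}(homog_expand (chart_homog hF)).
rewrite rmorph_sum coef_sum.
under eq_bigr do rewrite rmorphM /= eval_cst eval_mon expr1n mul1r coefCM expr0n.
case: leqP => [jt|tj].
  have hjk : ((inord j : 'I_t.+1) + (ord0 : 'I_t.+1) < t.+1)%N by rewrite addn0 ltn_ord.
  rewrite (bigD1 (exist _ (inord j, ord0) hjk)) //= !inordK; try lia.
  rewrite subn0 mulr1 coefXn eqxx mulr1 big1 ?addr0 // => x nx.
  case: eqP => ek; last by rewrite !mulr0 coef0 mulr0.
  rewrite mulr1 coefXn; case: eqP => ej; last by rewrite mulr0.
  case/negP: nx; rewrite -val_eqE /=; apply/eqP.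
  case: (val x) ej ek => a b /= -> ek; rewrite !inord_val.
  by congr (_, _); apply: val_inj.
rewrite big1 // => x _.
case: eqP => ek; last by rewrite !mulr0 coef0 mulr0.
rewrite mulr1 coefXn; case: eqP => ej; last by rewrite mulr0.
by have := ltn_ord (val x).1; rewrite -ej; lia.
Qed.

Lemma line_poly_size t F : homog3 t F -> (size (line_poly (fp A) (fq A) F) <= t.+1)%N.
Proof.
by move=> hF; apply/leq_sizeP => j tj; rewrite (line_poly_coef _ hF) leqNgt tj.
Qed.

(** By the coefficient formula every monomial of the chart contains x2, which corresponds to the
    linear form [fc] in the original coordinates. *)
Lemma line_poly_eq0 t F : homog3 t F -> line_poly (fp A) (fq A) F = 0 ->
  exists2 G, F = G * lin P (fc A) & forall k, t = k.+1 -> homog3 k G.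
Proof.
move=> hF l0.
have [|G cG] := homog_factor_x2 (chart_homog hF).
  move=> i j; case: (eqVneq (i + j + 0)%N t) => [et|nt].
    2: exact: coefs_homog (chart_homog hF) nt.
  have := line_poly_coef j hF; rewrite l0 coef0 -et.
  have -> : (j <= i + j + 0)%N by lia.
  by have -> : (i + j + 0 - j)%N = i by lia.
have eF : F = unchart G * lin P (fc A).
  by rewrite -(chartK F) cG rmorphM /unchart eval_x2.
exists (unchart G) => // k ek; rewrite ek in hF.
apply: (@homog3_divr _ _ _ _ (lin P (fc A))); [by rewrite -eF | exact: homog_lin |].
exact/lin_neq0/frame_fc_neq0.
Qed.

End Chart.
Arguments chart_homog {K P} A {t F}.

(** * Order of vanishing at a point and powers of its ideal *)

Section VanishingOrder.
Variables (K : fieldType) (P : poly3 K).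
Implicit Types (F G : P) (p q l x : pt K).

(* The germ of F at p, with T the radial variable and generic direction
   (x0, x1, x2): F vanishes to order n at p iff T^n divides it. *)
Definition germ p : {rmorphism P -> {poly P}} := eval P (polyC \o cst3 P)
  ((cst3 P (c0 p))%:P + (x0 P)%:P * 'X) ((cst3 P (c1 p))%:P + (x1 P)%:P * 'X)
  ((cst3 P (c2 p))%:P + (x2 P)%:P * 'X).

Definition vanish (n : nat) p F : Prop := forall i, (i < n)%N -> (germ p F)`_i = 0.

Lemma vanishP n p F : vanish n p F <-> exists Q, germ p F = Q * 'X^n.
Proof.
split=> [h|[Q e] i hi]; last by rewrite e coefMXn hi.
exists (drop_poly n (germ p F)); rewrite -{1}(poly_take_drop n (germ p F)).
suff -> : take_poly n (germ p F) = 0 by rewrite add0r.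
by apply/polyP=> i; rewrite coef_take_poly coef0; case: ltnP => // /h.
Qed.

Definition eval_pt p : {rmorphism P -> K} := eval P idfun (c0 p) (c1 p) (c2 p).

Lemma germ_coef0 p F : (germ p F)`_0 = cst3 P (eval_pt p F).
Proof.
pose g : {rmorphism {poly P} -> P} := horner_eval 0.
rewrite -horner_coef0 -[LHS]/(g (germ p F)) /germ.
rewrite (eval_comp (f' := cst3 P)); last by move=> k; rewrite /= /horner_eval hornerC.
rewrite [RHS](eval_comp (f' := cst3 P)) //.
by congr (eval _ _ _ _ _ _); rewrite /g /= /horner_eval !hornerE.
Qed.

(** [cone_ideal] and [ipow] are [I_pt] and [ideal_pow] transferred to the ring interface. *)
Definition cone_ideal p F : Prop :=
  forall c : K, eval_pt (c * c0 p, c * c1 p, c * c2 p) F = 0.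

Definition ipow (I : P -> Prop) (m : nat) F : Prop :=
  exists (n : nat) (g : 'I_n -> 'I_m -> P) (h : 'I_n -> P),
    (forall i j, I (g i j)) /\ F = \sum_(i < n) h i * \prod_(j < m) g i j.

(** The germ of an element of the ideal has zero constant term, hence is a multiple of T, and a
    product of m such germs is a multiple of T^m. *)
Lemma ipow_vanish m p F : ipow (cone_ideal p) m F -> vanish m p F.
Proof.
case=> n [g [h [gI ->]]]; apply/vanishP.
have gX i j : {Q | germ p (g i j) = Q * 'X}.
  apply: constructive_indefinite_description.
  have [|Q ->] := (vanishP 1 p (g i j)).1; last by exists Q.
  case=> // _; rewrite germ_coef0; have := gI i j 1; rewrite !mul1r.
  have -> : (c0 p, c1 p, c2 p) = p by apply: pt_ext.
  by move=> ->; rewrite rmorph0.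
exists (\sum_i germ p (h i) * \prod_j sval (gX i j)).
rewrite rmorph_sum mulr_suml; apply: eq_bigr => i _.
rewrite rmorphM rmorph_prod /= -mulrA; congr (_ * _).
under eq_bigr do rewrite (svalP (gX _ _)).
by rewrite big_split /= prodr_const card_ord.
Qed.

Lemma ipow0 I m : ipow I m 0.
Proof.
exists 0%N, (fun _ _ => 0), (fun _ => 0); split; first by case.
by rewrite big_ord0.
Qed.

Lemma ipowD I m F G : ipow I m F -> ipow I m G -> ipow I m (F + G).
Proof.
move=> [n [g [h [gI ->]]]] [n' [g' [h' [gI' ->]]]].
exists (n + n')%N, (fun i => match split i with inl a => g a | inr b => g' b end),
  (fun i => match split i with inl a => h a | inr b => h' b end).
split=> [i j|]; first by case: (split i).
rewrite big_split_ord /=; congr (_ + _); apply: eq_bigr => i _.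
  by rewrite (unsplitK (inl i)).
by rewrite (unsplitK (inr i)).
Qed.

Lemma ipowMl I m F G : ipow I m F -> ipow I m (G * F).
Proof.
move=> [n [g [h [gI ->]]]]; exists n, g, (fun i => G * h i); split=> //.
by rewrite mulr_sumr; apply: eq_bigr => i _; rewrite mulrA.
Qed.

Lemma ipow_prod I j k F G : I F -> I G -> ipow I (j + k) (F ^+ j * G ^+ k).
Proof.
move=> IF IG.
exists 1%N, (fun _ i => match split i with inl _ => F | inr _ => G end), (fun _ => 1).
split=> [_ i|]; first by case: (split i).
rewrite big_ord1 mul1r big_split_ord /=; congr (_ * _).
  under eq_bigr => i _ do rewrite (unsplitK (inl i)).
  by rewrite prodr_const card_ord.
under eq_bigr => i _ do rewrite (unsplitK (inr i)).
by rewrite prodr_const card_ord.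
Qed.

Lemma cone_ideal_lin l p : dot l p = 0 -> cone_ideal p (lin P l).
Proof.
move=> lp c; rewrite /eval_pt eval_lin /=.
by rewrite -[RHS](mulr0 c) -lp /dot /c0 /c1 /c2 /=; ring.
Qed.

(** A linear criterion for membership: the monomials left in the chart at [fp] have degree at least
    m in x1 and x2, which pull back to linear forms vanishing at [fp]. The bound [j + k <= t] spares
    the indices where [t - j - k] is truncated. *)
Lemma ipow_chart (A : frame K) m t F : homog3 t F ->
  (forall j k, (j + k < m)%N -> (j + k <= t)%N ->
     coefs (chart P A F) (t - j - k) j k = 0) ->
  ipow (cone_ideal (fp A)) m F.
Proof.
move=> hF h0; rewrite -(chartK A F) (homog_expand (chart_homog A hF)) rmorph_sum.
elim/big_ind: _ => [||x _]; [exact: ipow0 | exact: ipowD |].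
case: x => [[j k] /= hjk]; case: (ltnP (j + k) m) => [jkm|mjk].
  by rewrite h0 // rmorph0 mul0r rmorph0; apply: ipow0.
rewrite rmorphM {2}/unchart eval_mon -mulrA; do 2 apply: ipowMl.
(* Exactly m of the j + k factors are set aside, from the first form as far as possible; the others
   join the cofactor. *)
pose j' := minn j m; pose k' := (m - j')%N.
have -> : lin P (fb A) ^+ j * lin P (fc A) ^+ k = (lin P (fb A) ^+ (j - j') *
    lin P (fc A) ^+ (k - k')) * (lin P (fb A) ^+ j' * lin P (fc A) ^+ k').
  by rewrite mulrACA -!exprD !subnK // /k' /j'; lia.
apply: ipowMl; rewrite (_ : m = j' + k')%N; last by rewrite /k' /j'; lia.
by apply: ipow_prod; apply: cone_ideal_lin; [exact: frame_bp | exact: frame_cp].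
Qed.

Lemma germ_lin p l : germ p (lin P l) = (cst3 P (dot l p))%:P + (lin P l)%:P * 'X.
Proof.
by rewrite /germ eval_lin /= /dot /lin !rmorphD !rmorphM /=; ring.
Qed.

(** The germ of the linear form has the nonzero constant term l(p), so the coefficients of the germ
    of F vanish one after the other. *)
Lemma vanish_divl n p l F : vanish n p (F * lin P l) -> dot l p != 0 -> vanish n p F.
Proof.
move=> h lp; elim/ltn_ind => i IH hi; have := h i hi.
rewrite rmorphM germ_lin mulrDr coefD mulrA coefMX coefMC.
have -> : (if i == 0%N then 0 else (germ p F * (lin P l)%:P)`_i.-1) = 0.
  by case: i IH hi => [//|i] IH hi /=; rewrite coefMC IH ?mul0r //; lia.
rewrite addr0 => /eqP; rewrite mulf_eq0 => /orP [/eqP //|].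
by rewrite fmorph_eq0 (negPf lp).
Qed.

(** Since l(p) = 0, the germ of the linear form is exactly l T, and cancelling it shifts the
    coefficients by one. *)
Lemma vanish_divr n p l F : nonzero_pt l -> vanish n p (F * lin P l) ->
  dot l p = 0 -> vanish n.-1 p F.
Proof.
move=> l0 h lp i hi; have := h i.+1; rewrite rmorphM germ_lin lp rmorph0 add0r.
rewrite mulrA coefMX /= coefMC => /(_ ltac:(lia)) /eqP.
by rewrite mulf_eq0 (negPf (lin_neq0 P l0)) orbF => /eqP.
Qed.

(** In the germ at x = a p + b q, put T = u = X - b/a and take the direction a q. Then x + u a q = a
    (p + X q), so the germ specialises to a^t times the restriction, and T^n to u^n. *)
Lemma vanish_line_poly n t x p q a b F : homog3 t F -> vanish n x F ->
  x = pcomb a p b q -> a != 0 -> ('X - (b / a)%:P) ^+ n %| line_poly P p q F.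
Proof.
move=> hF /vanishP [Q gQ] ex a0.
pose e := eval P polyC (a * c0 q)%:P (a * c1 q)%:P (a * c2 q)%:P.
pose u : {poly K} := 'X - (b / a)%:P.
pose g : {rmorphism {poly P} -> {poly K}} := horner_morph (fun y => mulrC u (e y)).
have gC y : g y%:P = e y by exact: horner_morphC.
have gX : g 'X = u by exact: horner_morphX.
have gl (y r s : K) v : y = a * r + b * s -> e v = (a * s)%:P ->
    g ((cst3 P y)%:P + v%:P * 'X) = (r%:P + s%:P * 'X) * a%:P.
  move=> -> ev; rewrite rmorphD rmorphM !gC gX ev /e eval_cst /u.
  have -> : b = b / a * a by rewrite divfK.
  rewrite mulfK //; move: (b / a) => d; rewrite !rmorphD !rmorphM /=; ring.
have E : g (germ x F) = line_poly P p q F * a%:P ^+ t.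
  rewrite /germ (eval_comp (f' := polyC)); last by move=> k; rewrite /= gC /e eval_cst.
  rewrite (gl _ (c0 p) (c0 q)) ?ex ?/e ?eval_x0 // (gl _ (c1 p) (c1 q)) ?eval_x1 //.
  by rewrite (gl _ (c2 p) (c2 q)) ?eval_x2 // (eval_homog _ _ _ _ _ hF).
have aU : a%:P ^+ t != 0 :> {poly K} by rewrite expf_neq0 // polyC_eq0.
have : u ^+ n %| line_poly P p q F * a%:P ^+ t.
  by rewrite -E gQ rmorphM rmorphXn gX dvdp_mull.
by rewrite -polyC_exp mulrC mul_polyC dvdpZr // expf_neq0.
Qed.
End VanishingOrder.
Arguments vanish_divl {K P n p l F}.
Arguments vanish_divr {K P n p l F}.
Arguments ipow_vanish {K P m p F}.

(** * Forms of fixed degree as a finite-dimensional vector space *)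

Section FormSpaces.
Variables (K : fieldType) (P : poly3 K).
Implicit Types F G : P.

Lemma linfun_ex (V W : vectType K) (f : V -> W) :
  (forall a u v, f (a *: u + v) = a *: f u + f v) ->
  exists g : 'Hom(V, W), forall v, g v = f v.
Proof.
move=> lf; pose ff : {linear V -> W} := HB.pack f (GRing.isLinear.Build K V W *:%R f lf).
by exists (linfun ff) => v; rewrite lfunE.
Qed.

Lemma dim_limg_le (V W : vectType K) (g : 'Hom(V, W)) (U : {vspace V}) :
  (\dim (g @: U)%VS <= \dim U)%N.
Proof. by rewrite -(limg_ker_dim g U) leq_addl. Qed.

(** A subspace contained in [S] is enlarged one vector at a time until it exhausts [S]; [n] bounds
    the number of steps left. Excluded middle decides whether a vector is missing. *)
Lemma subspace_ex (V : vectType K) (S : V -> Prop) : S 0 ->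
  (forall a u v, S u -> S v -> S (a *: u + v)) ->
  exists U : {vspace V}, forall v, v \in U <-> S v.
Proof.
move=> S0 SD.
suff H n : forall U : {vspace V}, (forall v, v \in U -> S v) ->
    (\dim {:V} <= \dim U + n)%N -> exists U' : {vspace V}, forall v, v \in U' <-> S v.
  apply: (H (\dim {:V}) 0%VS) => [v|]; last exact: leq_addl.
  by rewrite memv0 => /eqP ->.
elim: n => [|n IH] U US hn.
  exists U => v; split; first exact: US.
  have -> : U = fullv by apply/eqP; rewrite eqEdim subvf -(addn0 (\dim U)).
  by rewrite memvf.
case: (classic (exists2 v, S v & v \notin U)) => [[v Sv vU]|no]; last first.
  exists U => v; split=> [/US //|Sv]; apply/negPn/negP => vU.
  by apply: no; exists v.
apply: (IH (U + <[v]>)%VS) => [w /memv_addP [u uU [w' /vlineP [k ->] ->]]|].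
  by rewrite addrC; apply: SD => //; apply: US.
have lt : (\dim U < \dim (U + <[v]>)%VS)%N.
  rewrite ltnNge; apply: contra vU => le; have := eqEdim U (U + <[v]>)%VS.
  rewrite addvSl le => /eqP ->; exact: subvP (addvSr _ _) _ (memv_line v).
lia.
Qed.

Lemma card_tri_idx n : #|{: tri_idx n}| = 'C(n.+1, 2).
Proof.
rewrite card_sig -sum1_card /=.
rewrite -(pair_big_dep xpredT (fun i j : 'I_n => i + j < n)%N (fun _ _ => 1%N)) /=.
rewrite -bin2_sum big_nat_recl // add0n big_mkord (reindex_inj rev_ord_inj) /=.
apply: eq_bigr => i _.
rewrite (eq_bigl (fun j : 'I_n => j < i.+1)%N) => [|j]; last first.
  by have hi := ltn_ord i; rewrite /=; apply/idP/idP; lia.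
rewrite big_ord_narrow; first exact: ltn_ord.
by rewrite sum_nat_const card_ord muln1.
Qed.

(** The ring is infinite-dimensional, so forms of degree t are replaced by coefficient vectors;
    [form] and [form_coord] are mutually inverse on forms of that degree. *)
Definition fspace t := 'rV[K]_(#|{: tri_idx t.+1}|).

Definition form t (v : fspace t) : P := \sum_(x : tri_idx t.+1)
  cst3 P (v 0 (enum_rank x)) * mon P (t - (val x).1 - (val x).2) (val x).1 (val x).2.

Definition form_coord t F : fspace t := \row_(e < #|{: tri_idx t.+1}|)
  let x := val (enum_val e : tri_idx t.+1) in coefs F (t - x.1 - x.2) x.1 x.2.

Lemma dim_fspace t : \dim {: fspace t} = 'C(t.+2, 2).
Proof. by rewrite dimvf /dim /= mul1n card_tri_idx. Qed.

Lemma form_lin t a (u v : fspace t) : form (a *: u + v) = cst3 P a * form u + form v.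
Proof.
rewrite /form mulr_sumr -big_split; apply: eq_bigr => x _ /=.
by rewrite !mxE rmorphD rmorphM mulrDl mulrA.
Qed.

Lemma form0 t : form (0 : fspace t) = 0.
Proof. by rewrite /form big1 // => x _; rewrite mxE rmorph0 mul0r. Qed.

Lemma form_homog t (v : fspace t) : homog3 t (form v).
Proof.
rewrite /form; elim/big_ind: _ => [||x _]; [exact: homog3_0|exact: homog3D|].
apply: homog3Z; case: x => [[j k] /= h]; have := @homog3_mon _ P (t - j - k) j k.
by have -> : (t - j - k + j + k)%N = t by lia.
Qed.

Lemma form_coordK t F : homog3 t F -> form (form_coord t F) = F.
Proof.
move=> hF; rewrite [RHS](homog_expand hF); apply: eq_bigr => x _.
by rewrite mxE enum_rankK.
Qed.

Lemma formK t (v : fspace t) : form_coord t (form v) = v.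
Proof.
apply/rowP => e; rewrite mxE /form coefs_sum (bigD1 (enum_val e)) //=.
rewrite coefsZ coefs_mon !eqxx mulr1 enum_valK big1 ?addr0 // => x nx.
rewrite coefsZ coefs_mon; case: and3P => [[_ /eqP e1 /eqP e2]|_]; last by rewrite mulr0.
case/negP: nx; rewrite -val_eqE /=; apply/eqP.
have e1' := val_inj e1; have e2' := val_inj e2.
by rewrite [val x]surjective_pairing [RHS]surjective_pairing -e1' -e2'.
Qed.

Lemma form_coord_lin t a F G :
  form_coord t (cst3 P a * F + G) = a *: form_coord t F + form_coord t G.
Proof. by apply/rowP => e; rewrite !mxE /= coefsD coefsZ. Qed.

Lemma form_sum t n (c : 'I_n -> K) (v : 'I_n -> fspace t) :
  form (\sum_i c i *: v i) = \sum_i cst3 P (c i) * form (v i).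
Proof.
elim/big_rec2: _ => [|i x y _ <-]; first exact: form0.
exact: form_lin.
Qed.

Definition lin_indep3 (r : nat) (f : 'I_r -> P) : Prop :=
  forall c : 'I_r -> K, \sum_(i < r) cst3 P (c i) * f i = 0 -> forall i, c i = 0.

Definition has_dim3 (S : P -> Prop) (d : nat) : Prop :=
  (exists f : 'I_d -> P, (forall i, S (f i)) /\ lin_indep3 f) /\
  (forall f : 'I_d.+1 -> P, (forall i, S (f i)) -> ~ lin_indep3 f).

Lemma has_dim3_uniq S d d' : has_dim3 S d -> has_dim3 S d' -> d = d'.
Proof.
have H e e' : has_dim3 S e -> has_dim3 S e' -> (e < e')%N -> False.
  move=> [_ no] [[f [Sf indf]] _] lt; apply: (no (f \o widen_ord lt)) => [i|c h i].
    exact: Sf.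
  (* A relation among the first members of the longer family extends by zero to all of it. *)
  pose c' (j : 'I_e') := if insub (val j) is Some k then c k else 0.
  have -> : c i = c' (widen_ord lt i) by rewrite /c' /= valK.
  apply: indf; rewrite -[RHS]h (bigID (fun j : 'I_e' => (j < e.+1)%N)) /= addrC big1.
    rewrite add0r (big_ord_narrow lt); apply: eq_bigr => j _; by rewrite /c' /= valK.
  by move=> j nj; rewrite /c' insubF ?rmorph0 ?mul0r //; apply/negbTE.
by move=> hd hd'; case: (ltngtP d d') => // lt; case: (H _ _ _ _ lt).
Qed.

Lemma has_dim3_vspace t (S : P -> Prop) (U : {vspace fspace t}) :
  (forall F, S F -> homog3 t F) -> (forall v, v \in U <-> S (form v)) ->
  has_dim3 S (\dim U).
Proof.
move=> Sh US; split.
  exists (fun i => form (vbasis U)`_i); split=> [i|c].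
    by apply/US/vbasis_mem/mem_nth; rewrite size_tuple.
  rewrite -form_sum => h; have /freeP fr := basis_free (vbasisP U).
  by apply: fr; rewrite -[LHS]formK h -(form0 t) formK.
move=> f Sf indf; pose X := [tuple form_coord t (f i) | i < (\dim U).+1].
have fX : free X.
  apply/freeP => k h; apply: indf; transitivity (form (\sum_i k i *: X`_i)).
    rewrite form_sum; apply: eq_bigr => i _.
    by rewrite -tnth_nth tnth_mktuple form_coordK //; apply: Sh.
  by rewrite h form0.
have : (<<X>> <= U)%VS.
  apply/span_subvP => _ /tnthP [i ->]; rewrite tnth_mktuple; apply/US.
  by rewrite form_coordK //; apply: Sh.
by move/dimvS; move: fX; rewrite /free size_tuple => /eqP ->; rewrite ltnn.
Qed.
End FormSpaces.
Arguments form_homog {K} P {t} v.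

(** * Incidence of points and lines *)

Section Lines.
Variable K : fieldType.
Implicit Types p q l x y : pt K.

Lemma on_lineE l p : on_line l p = (dot l p == 0).
Proof. by []. Qed.

Lemma proj_eq_sym p q : proj_eq p q = proj_eq q p.
Proof.
rewrite /proj_eq; congr [&& _, _ & _]; rewrite eq_sym;
by congr (_ == _); rewrite mulrC.
Qed.

Lemma proj_eq_refl p : proj_eq p p.
Proof. by rewrite /proj_eq; apply/and3P; split; rewrite mulrC. Qed.

Lemma proj_eqP p q : nonzero_pt p -> proj_eq p q ->
  exists c, q = (c * c0 p, c * c1 p, c * c2 p).
Proof.
move=> + /and3P [/eqP h1 /eqP h2 /eqP h3] => /or3P [nz|nz|nz].
- exists (c0 q / c0 p); apply: pt_ext; rewrite /c0 /c1 /c2 /= -/(c0 p) -/(c0 q)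
   -/(c1 p) -/(c1 q) -/(c2 p) -/(c2 q); apply: (mulfI nz); rewrite ?h1 ?h2; field => //.
- exists (c1 q / c1 p); apply: pt_ext; rewrite /c0 /c1 /c2 /= -/(c0 p) -/(c0 q)
   -/(c1 p) -/(c1 q) -/(c2 p) -/(c2 q); apply: (mulfI nz); rewrite -?h1 ?h3; field => //.
- exists (c2 q / c2 p); apply: pt_ext; rewrite /c0 /c1 /c2 /= -/(c0 p) -/(c0 q)
   -/(c1 p) -/(c1 q) -/(c2 p) -/(c2 q); apply: (mulfI nz); rewrite -?h2 -?h3; field => //.
Qed.

Lemma proj_eq_scale a b p : proj_eq (a * c0 p, a * c1 p, a * c2 p) (b * c0 p, b * c1 p, b * c2 p).
Proof. by rewrite /proj_eq /c0 /c1 /c2 /=; apply/and3P; split; apply/eqP; ring. Qed.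

Lemma proj_eq_trans q p r : nonzero_pt q -> proj_eq p q -> proj_eq q r -> proj_eq p r.
Proof.
move=> nq; rewrite proj_eq_sym => /(proj_eqP nq) [a ->] /(proj_eqP nq) [b ->].
exact: proj_eq_scale.
Qed.

(** Only the [fw] component of a decomposition along the frame survives, so any line through [fp]
    and [fq] is proportional to [fc]. *)
Lemma line_frame (A : frame K) l : on_line l (fp A) -> on_line l (fq A) ->
  forall x, dot l x = dot l (fw A) * dot (fc A) x.
Proof.
rewrite !on_lineE => /eqP hp /eqP hq x; rewrite {1}(frame_decomp A x) !dot_pcomb hp hq.
by ring.
Qed.

Lemma line_frame_eq (A : frame K) l : on_line l (fp A) -> on_line l (fq A) ->
  l = (dot l (fw A) * c0 (fc A), dot l (fw A) * c1 (fc A), dot l (fw A) * c2 (fc A)).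
Proof.
move=> hp hq; apply: pt_ext; [rewrite -[LHS]dot100 | rewrite -[LHS]dot010
  | rewrite -[LHS]dot001]; by rewrite (line_frame hp hq) ?dot100 ?dot010 ?dot001.
Qed.

Lemma line_frame_eq0 (A : frame K) l : nonzero_pt l ->
  on_line l (fp A) -> on_line l (fq A) -> forall x, on_line l x = (dot (fc A) x == 0).
Proof.
move=> nl hp hq x; rewrite on_lineE (line_frame hp hq) mulf_eq0.
case: eqP => // h0; move: nl; rewrite /nonzero_pt.
by rewrite (line_frame_eq hp hq) h0 /c0 /c1 /c2 /= !mul0r eqxx.
Qed.

Lemma two_points_line p q l l' : nonzero_pt l -> nonzero_pt l' -> ~~ proj_eq p q ->
  on_line l p -> on_line l q -> on_line l' p -> on_line l' q -> proj_eq l l'.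
Proof.
move=> nl nl' /frame_ex [A [<- <-]] h1 h2 h3 h4.
rewrite (line_frame_eq h1 h2) (line_frame_eq h3 h4); exact: proj_eq_scale.
Qed.

Lemma line_frame_comb (A : frame K) l x : nonzero_pt l ->
  on_line l (fp A) -> on_line l (fq A) -> on_line l x ->
  x = pcomb (dot (fa A) x) (fp A) (dot (fb A) x) (fq A).
Proof.
move=> nl hp hq; rewrite (line_frame_eq0 nl hp hq) => /eqP h.
rewrite {1}(frame_decomp A x) h; apply: pt_ext;
by rewrite ?c0_pcomb ?c1_pcomb ?c2_pcomb mul1r mul0r addr0.
Qed.

Lemma line_frame_coord_neq0 (A : frame K) l x : nonzero_pt l ->
  on_line l (fp A) -> on_line l (fq A) -> on_line l x ->
  ~~ proj_eq (fq A) x -> dot (fa A) x != 0.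
Proof.
move=> nl hp hq hx; apply: contra => /eqP h; rewrite (line_frame_comb nl hp hq hx) h.
rewrite /proj_eq !c0_pcomb !c1_pcomb !c2_pcomb.
by apply/and3P; split; apply/eqP; ring.
Qed.

Lemma line_frame_coord_inj (A : frame K) l x y : nonzero_pt l ->
  on_line l (fp A) -> on_line l (fq A) -> on_line l x -> on_line l y ->
  ~~ proj_eq (fq A) x -> ~~ proj_eq (fq A) y ->
  dot (fb A) x / dot (fa A) x = dot (fb A) y / dot (fa A) y -> proj_eq x y.
Proof.
move=> nl hp hq hx hy nx ny.
have ax := line_frame_coord_neq0 nl hp hq hx nx.
have ay := line_frame_coord_neq0 nl hp hq hy ny.
rewrite [in proj_eq _ _](line_frame_comb nl hp hq hx).
rewrite [in X in proj_eq _ X](line_frame_comb nl hp hq hy).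
move: (dot (fa A) x) (dot (fb A) x) (dot (fa A) y) (dot (fb A) y) ax ay.
move=> a b a' b' a0 a0' e.
have -> : b = b' / a' * a by rewrite -e divfK.
have -> : b' = b' / a' * a' by rewrite divfK.
rewrite mulfK //; move: (b' / a') => d.
rewrite /proj_eq !c0_pcomb !c1_pcomb !c2_pcomb.
by apply/and3P; split; apply/eqP; ring.
Qed.

Lemma line_two_points l : nonzero_pt l ->
  exists p q, [/\ on_line l p, on_line l q & ~~ proj_eq p q].
Proof.
have dot3 (x y z : K) : dot l (x, y, z) = c0 l * x + c1 l * y + c2 l * z by [].
have proj3 (a b c a' b' c' : K) : proj_eq (a, b, c) (a', b', c') =
  [&& a * b' == b * a', a * c' == c * a' & b * c' == c * b'] by [].
(* The witnesses are intersections with two coordinate lines; the minor separating them is, up to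
   sign, the square of the nonzero coordinate. *)
case/or3P => nz.
- exists (c1 l, - c0 l, 0), (c2 l, 0, - c0 l); rewrite !on_lineE !dot3 proj3.
  split; [by apply/eqP; ring | by apply/eqP; ring |].
  by apply/and3P => -[_ _]; rewrite mul0r mulrNN mulf_eq0 orbb (negPf nz).
- exists (c1 l, - c0 l, 0), (0, c2 l, - c1 l); rewrite !on_lineE !dot3 proj3.
  split; [by apply/eqP; ring | by apply/eqP; ring |].
  by apply/and3P => -[_ + _]; rewrite mul0r mulrN oppr_eq0 mulf_eq0 orbb (negPf nz).
- exists (c2 l, 0, - c0 l), (0, c2 l, - c1 l); rewrite !on_lineE !dot3 proj3.
  split; [by apply/eqP; ring | by apply/eqP; ring |].
  by apply/and3P => -[+ _ _]; rewrite mul0r mulf_eq0 orbb (negPf nz).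
Qed.

End Lines.

(** * Polynomials with prescribed roots, and generic points of a line *)

Lemma dvdp_prod_XsubC (K : fieldType) (T : eqType) (s : seq T) (a : T -> K)
    (n : T -> nat) (f : {poly K}) :
  {in s &, injective a} -> uniq s ->
  (forall x, x \in s -> ('X - (a x)%:P) ^+ n x %| f) ->
  \prod_(x <- s) ('X - (a x)%:P) ^+ n x %| f.
Proof.
elim: s => [|x s IH] inj /=; first by rewrite big_nil dvd1p.
case/andP=> xs us h; rewrite big_cons Gauss_dvdp; last first.
  apply: coprimep_expl; rewrite coprimep_sym coprimep_XsubC.
  rewrite rootE horner_prod prodf_seq_neq0; apply/allP => y ys /=.
  rewrite horner_exp expf_neq0 // hornerXsubC subr_eq0.
  apply: contraNneq xs => /inj; rewrite !inE eqxx ys orbT => -> //.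
rewrite h ?mem_head //=; apply: IH => // [y z ys zs|y ys]; last by apply: h; rewrite inE ys orbT.
by apply: inj; rewrite inE ?ys ?zs orbT.
Qed.

Lemma size_prod_XsubC_exp (K : fieldType) (T : Type) (s : seq T) (a : T -> K) (n : T -> nat) :
  size (\prod_(x <- s) ('X - (a x)%:P) ^+ n x) = (\sum_(x <- s) n x).+1.
Proof.
elim: s => [|x s IH]; first by rewrite !big_nil size_poly1.
have mon : \prod_(y <- s) ('X - (a y)%:P) ^+ n y \is monic.
  by apply: monic_prod => y _; apply/monic_exp/monicXsubC.
rewrite !big_cons size_Mmonic // ?expf_neq0 ?polyXsubC_eq0 //.
by rewrite IH size_exp_XsubC addnS addSn.
Qed.

(** For the points p + c q of the line, being proportional to a given [x] makes a nonzero polynomial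
    in c vanish; the product of these finitely many polynomials has a nonroot. *)
Lemma generic_point (K : closedFieldType) (l : pt K) (X : seq (pt K)) :
  nonzero_pt l -> (forall x, x \in X -> nonzero_pt x) ->
  exists2 q, on_line l q & forall x, x \in X -> ~~ proj_eq q x.
Proof.
move=> nl nX; have [p [q [hp hq npq]]] := line_two_points nl.
(* The 2 by 2 minor of p + T q and x in the coordinates [a], [b], as a polynomial in T. *)
pose f (a b : pt K -> K) x : {poly K} :=
  (a p * b x - b p * a x)%:P + (a q * b x - b q * a x)%:P * 'X.
have [g g0 hg] : exists2 g : {poly K}, g != 0 & forall c x, x \in X -> ~~ root g c ->
    ~~ proj_eq (pcomb 1 p c q) x.
  elim: X nX => [|x X IH] nX; first by exists 1; rewrite ?oner_neq0.
  have [|g g0 hg] := IH; first by move=> y yX; apply: nX; rewrite inE yX orbT.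
  suff [h h0 hh] : exists2 h : {poly K}, h != 0 & forall c, ~~ root h c ->
      ~~ proj_eq (pcomb 1 p c q) x.
    exists (h * g) => [|c y]; first by rewrite mulf_neq0.
    rewrite rootM negb_or inE => /predU1P [->|yX] /andP [r1 r2]; [exact: hh | exact: hg].
  have rt a b c : ~~ root (f a b x) c ->
      (a p + c * a q) * b x != (b p + c * b q) * a x.
    have e : (f a b x).[c] = (a p + c * a q) * b x - (b p + c * b q) * a x.
      by rewrite /f hornerD hornerM hornerX !hornerC; ring.
    by rewrite rootE e subr_eq0.
  have f0 a b : f a b x = 0 -> a p * b x = b p * a x /\ a q * b x = b q * a x.
    move=> e; split; apply/eqP; rewrite -subr_eq0; apply/eqP.
      by have := congr1 (fun r : {poly K} => r`_0) e;
        rewrite /f coefD coefMX !coefC /= addr0.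
    by have := congr1 (fun r : {poly K} => r`_1) e;
      rewrite /f coefD coefMX !coefC /= add0r.
  case: (eqVneq (f c0 c1 x) 0) => [/f0 [e1 e2]|n0]; last first.
    exists (f c0 c1 x) => // c /rt; apply: contraNN => /and3P [/eqP h _ _].
    by move: h; rewrite !c0_pcomb !c1_pcomb !mul1r => ->.
  case: (eqVneq (f c0 c2 x) 0) => [/f0 [e3 e4]|n0]; last first.
    exists (f c0 c2 x) => // c /rt; apply: contraNN => /and3P [_ /eqP h _].
    by move: h; rewrite !c0_pcomb !c2_pcomb !mul1r => ->.
  case: (eqVneq (f c1 c2 x) 0) => [/f0 [e5 e6]|n0]; last first.
    exists (f c1 c2 x) => // c /rt; apply: contraNN => /and3P [_ _ /eqP h].
    by move: h; rewrite !c1_pcomb !c2_pcomb !mul1r => ->.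
  (* If all three minors vanish identically, [x] is proportional to both [p] and [q], which are not
     proportional to each other. *)
  case/negP: npq; apply: (@proj_eq_trans _ x); first by apply: nX; rewrite mem_head.
    by apply/and3P; split; apply/eqP.
  by rewrite proj_eq_sym; apply/and3P; split; apply/eqP.
have /closed_nonrootP [c rc] := g0.
exists (pcomb 1 p c q) => [|x xX]; last exact: hg.
by move: hp hq; rewrite !on_lineE dot_pcomb => /eqP -> /eqP ->; rewrite !mulr0 addr0.
Qed.

(** * The restriction inequality and the lower bound for fat points *)

Section LineRestriction.
Variables (K : closedFieldType) (P : poly3 K).
Implicit Types (l x y : pt K) (X : seq (pt K)).

Definition proj_set X : Prop := [/\ uniq X, forall x, x \in X -> nonzero_pt x
  & {in X &, forall x y, proj_eq x y -> x = y}].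

Lemma generic_line_point l X : nonzero_pt l -> proj_set X ->
  exists q, [/\ nonzero_pt q, on_line l q & forall x, x \in X -> ~~ proj_eq q x].
Proof.
(* The zero triple is proportional to every triple, so avoiding the extra point (1,0,0) makes [q]
   nonzero even if [X] is empty. *)
move=> nl [_ nX _]; have [x|q lq hq] := @generic_point K l ((1, 0, 0) :: X) nl.
  by rewrite inE => /predU1P [->|/nX //]; rewrite /nonzero_pt /c0 /= oner_neq0.
exists q; split=> // [|x xX]; last by apply: hq; rewrite inE xX orbT.
apply/negPn/negP; rewrite /nonzero_pt !negb_or !negbK => /and3P [/eqP e0 /eqP e1 /eqP e2].
have /negP := hq _ (mem_head _ _); apply.
by rewrite /proj_eq e0 e1 e2 !mul0r !eqxx.
Qed.

Lemma generic_frame l X : nonzero_pt l -> proj_set X -> exists A : frame K,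
  [/\ on_line l (fp A), on_line l (fq A) & forall x, x \in X -> ~~ proj_eq (fq A) x].
Proof.
move=> nl pX; have [q [nq lq hq]] := generic_line_point nl pX.
have [x|p lp hp] := @generic_point K l [:: q] nl; first by rewrite inE => /eqP ->.
have [A [ep eq]] := frame_ex (hp _ (mem_head _ _)).
by exists A; rewrite ep eq.
Qed.

(** For [x] on the line through [fp] and [fq], the parameter T at which fp + T fq is proportional to
    [x]. *)
Definition line_coord (A : frame K) x : K := dot (fb A) x / dot (fa A) x.

(** The divisor cut out on the line by the scheme with multiplicity [n x] at each point. *)
Definition line_divisor (A : frame K) l X (n : pt K -> nat) : {poly K} :=
  \prod_(x <- [seq x <- X | on_line l x]) ('X - (line_coord A x)%:P) ^+ n x.

Lemma size_line_divisor A l X n :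
  size (line_divisor A l X n) = (\sum_(x <- X | on_line l x) n x).+1.
Proof. by rewrite /line_divisor size_prod_XsubC_exp big_filter. Qed.

Lemma line_divisor_dvd A l X n t (F : P) :
  nonzero_pt l -> proj_set X -> homog3 t F ->
  on_line l (fp A) -> on_line l (fq A) ->
  (forall x, x \in X -> ~~ proj_eq (fq A) x) ->
  (forall x, x \in X -> on_line l x ->
     ('X - (line_coord A x)%:P) ^+ n x %| line_poly P (fp A) (fq A) F) ->
  line_divisor A l X n %| line_poly P (fp A) (fq A) F.
Proof.
move=> nl [uX nX iX] hF lp lq gq h; apply: dvdp_prod_XsubC.
- move=> x y; rewrite !mem_filter => /andP [lx xX] /andP [ly yX] e.
  apply: iX => //; exact: (line_frame_coord_inj nl lp lq lx ly (gq _ xX) (gq _ yX) e).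
- exact: filter_uniq.
- by move=> x; rewrite mem_filter => /andP [lx xX]; apply: h.
Qed.

Lemma vanish_line_divisor A l x n t (F : P) :
  nonzero_pt l -> homog3 t F -> on_line l (fp A) -> on_line l (fq A) ->
  ~~ proj_eq (fq A) x -> on_line l x -> vanish n x F ->
  ('X - (line_coord A x)%:P) ^+ n %| line_poly P (fp A) (fq A) F.
Proof.
move=> nl hF lp lq gq lx vF; apply: (vanish_line_poly hF vF).
  exact: (line_frame_comb nl lp lq lx).
exact: line_frame_coord_neq0 nl lp lq lx gq.
Qed.

Lemma line_poly_lin (A : frame K) a t (u v : fspace K t) :
  line_poly P (fp A) (fq A) (form P (a *: u + v)) =
  a *: line_poly P (fp A) (fq A) (form P u) + line_poly P (fp A) (fq A) (form P v).
Proof. by rewrite form_lin rmorphD rmorphM -mul_polyC /line_poly eval_cst. Qed.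

Lemma vanish_lin n x a (F G : P) :
  vanish n x F -> vanish n x G -> vanish n x (cst3 P a * F + G).
Proof.
move=> hF hG i hi; rewrite rmorphD rmorphM /germ eval_cst coefD /= coefCM.
by rewrite [X in _ * X]hF // [X in _ + X]hG // mulr0 addr0.
Qed.

Lemma vanish_space_ex X (mu : pt K -> nat) t : exists U : {vspace fspace K t},
  forall v, v \in U <-> (forall x, x \in X -> vanish (mu x) x (form P v)).
Proof.
apply: subspace_ex => [x _|a u v hu hv x xX]; first by rewrite form0 => i; rewrite rmorph0 coef0.
by rewrite form_lin; apply: vanish_lin; [apply: hu | apply: hv].
Qed.

(** Rank-nullity for restriction to [l]: the kernel comes from [U'] by multiplication with the
    equation of [l], and the image consists of multiples of a fixed divisor. Truncated subtraction
    covers a divisor so large that the image is zero. *)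
Lemma peel_line X l (mu : pt K -> nat) t
    (U : {vspace fspace K t.+1}) (U' : {vspace fspace K t}) :
  nonzero_pt l -> proj_set X ->
  (forall v, v \in U <-> (forall x, x \in X -> vanish (mu x) x (form P v))) ->
  (forall v, v \in U' <->
     (forall x, x \in X -> vanish (mu x - on_line l x) x (form P v))) ->
  (\dim U <= \dim U' + (t.+2 - \sum_(x <- X | on_line l x) mu x))%N.
Proof.
move=> nl pX hU hU'; have [A [lp lq gq]] := generic_frame nl pX.
pose L (v : fspace K t.+1) := line_poly P (fp A) (fq A) (form P v).
have [res resE] : exists g : 'Hom(fspace K t.+1, 'rV[K]_(t.+2)), forall v, g v = poly_rV (L v).
  by apply: linfun_ex => a u v; rewrite /L line_poly_lin linearP.
have [mul mulE] : exists g : 'Hom(fspace K t, fspace K t.+1), forall v,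
    g v = form_coord t.+1 (form P v * lin P (fc A)).
  by apply: linfun_ex => a u v; rewrite form_lin mulrDl -mulrA form_coord_lin.
have sL v : (size (L v) <= t.+2)%N by have := line_poly_size A (form_homog P v).
rewrite -(limg_ker_dim res U); apply: leq_add.
  apply: leq_trans (dim_limg_le mul U'); apply/dimvS/subvP => v.
  rewrite memv_cap memv_ker resE => /andP [/hU vU /eqP r0].
  have L0 : L v = 0 by rewrite -(poly_rV_K (sL v)) r0 linear0.
  have [G eG hG] := line_poly_eq0 (form_homog P v) L0.
  apply/memv_imgP; exists (form_coord t G); last first.
    by rewrite mulE form_coordK -?eG ?formK //; apply: hG.
  apply/hU' => x xX; rewrite form_coordK; last exact: hG.
  have := vU _ xX; rewrite eG (line_frame_eq0 nl lp lq) => vx.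
  case: eqP => [d0|/eqP dn]; last by rewrite subn0; apply: vanish_divl vx dn.
  by rewrite subn1; apply: vanish_divr vx d0; exact: frame_fc_neq0.
(* The restriction has at most t+2 coefficients and is divisible by [M], of degree [N], which leaves
   at most t+2-N coefficients for the quotient. *)
set M := line_divisor A l X mu; set N := (\sum_(x <- X | on_line l x) mu x)%N.
have sM : size M = N.+1 by exact: size_line_divisor.
have [muM muME] : exists g : 'Hom('rV[K]_(t.+2 - N), 'rV[K]_(t.+2)),
    forall w, g w = poly_rV (M * rVpoly w).
  by apply: linfun_ex => a u v; rewrite linearP mulrDr -scalerAr linearP.
have -> : (t.+2 - N)%N = \dim {: 'rV[K]_(t.+2 - N)} by rewrite dimvf /dim /= mul1n.
apply: leq_trans (dim_limg_le muM fullv); apply/dimvS/subvP => w /memv_imgP [v vU ->].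
rewrite resE; have /dvdpP [Q eQ] : M %| L v.
  apply: (line_divisor_dvd nl pX (form_homog P v)) => // x xX lx.
  apply: (vanish_line_divisor nl (form_homog P v)) => //; first exact: gq.
  by have /hU := vU; apply.
have sQ : (size Q <= t.+2 - N)%N.
  case: (eqVneq Q 0) => [->|Q0]; first by rewrite size_poly0.
  have M0 : M != 0 by rewrite -size_poly_eq0 sM.
  by have := sL v; rewrite eQ size_mul // sM addnS /= -{2}(addnK N (size Q)) => /leq_sub2r.
apply/memv_imgP; exists (poly_rV Q); first exact: memvf.
by rewrite muME poly_rV_K // eQ mulrC.
Qed.

(** [h] picks on each line of [Ls] a point of [X] lying on no other line of [Ls]. One condition at
    that point is omitted, yet all solutions still lie in the fat ideal, so each line gains one
    dimension. *)
Lemma fat_dim_ge X m t (Ls : seq (pt K)) (h : pt K -> pt K) (U : {vspace fspace K t}) :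
  (0 < m)%N -> proj_set X -> uniq Ls -> (forall l, l \in Ls -> nonzero_pt l) ->
  (forall l, l \in Ls -> h l \in X /\ on_line l (h l)) ->
  {in Ls &, forall l l', on_line l' (h l) -> l' = l} ->
  (forall l, l \in Ls -> (t.+1 < m * count (on_line l) X)%N) ->
  (forall v, (forall x, x \in X -> ipow (cone_ideal (P := P) x) m (form P v)) -> v \in U) ->
  ('C(t.+2, 2) + size Ls <= \dim U + size X * 'C(m.+1, 2))%N.
Proof.
move=> m0 pX uL nL hX hL ht hU.
(* At a chosen point [h l] the second vector of the frame lies on [l], so that x1 is the direction
   along [l]; at other points any frame will do. *)
have [fr frP] : exists fr : pt K -> frame K, forall x, x \in X -> fp (fr x) = x /\
    forall l, l \in Ls -> h l = x -> on_line l (fq (fr x)) /\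
      forall y, y \in X -> ~~ proj_eq (fq (fr x)) y.
  have [A0 _] : exists A : frame K, fp A = (1, 0, 0) /\ fq A = (0, 1, 0).
    by apply: frame_ex; rewrite /proj_eq /c0 /c1 /c2 /= mulr1 mulr0 oner_eq0.
  have ex x : exists A : frame K, x \in X -> fp A = x /\
    forall l, l \in Ls -> h l = x -> on_line l (fq A) /\
      forall y, y \in X -> ~~ proj_eq (fq A) y.
    case: (boolP (x \in X)) => [xX|]; last by exists A0.
    have [uX nX _] := pX.
    case: (boolP (has (fun l => h l == x) Ls)) => [/hasP [l lL /eqP hl]|no].
      have [q [nq lq gq]] := generic_line_point (nL _ lL) pX.
      have [|A [ep eq]] := @frame_ex _ x q; first by rewrite proj_eq_sym gq.
      exists A => _; rewrite ep eq; split=> // l' l'L hl'.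
      have -> // : l' = l by apply: hL => //; rewrite hl -hl'; case: (hX _ l'L).
    have [q [nq lq gq]] := generic_line_point (nX _ xX) pX.
    have [|A [ep eq]] := @frame_ex _ x q; first by rewrite proj_eq_sym gq.
    exists A => _; split=> // l lL hl; case/hasP: no; exists l => //; exact/eqP.
  exists (fun x => sval (constructive_indefinite_description _ (ex x))) => x.
  exact: (svalP (constructive_indefinite_description _ (ex x))).
pose I : finType := ('I_(size X) * tri_idx m)%type.
pose o : pt K := (0, 0, 0).
pose pnt (i : 'I_(size X)) := nth o X i.
pose cond (e : I) (v : fspace K t) : K :=
  coefs (chart P (fr (pnt e.1)) (form P v)) (t - (val e.2).1 - (val e.2).2)
    (val e.2).1 (val e.2).2.
(* An index j = m-1 forces k = 0: this is the condition of order m-1 along the line. *)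
pose drop := [set e : I | has (fun l => h l == pnt e.1) Ls & (val e.2).1 == m.-1 :> nat].
have card_drop : (size Ls <= #|drop|)%N.
  have hm1 : (m.-1 < m)%N by rewrite prednK.
  have hm : ((Ordinal hm1) + (Ordinal m0) < m)%N by rewrite addn0.
  pose top : tri_idx m := exist _ (Ordinal hm1, Ordinal m0) hm.
  have idx (i : 'I_(size Ls)) : (index (h (nth o Ls i)) X < size X)%N.
    by rewrite index_mem; case: (hX (nth o Ls i)) => //; apply: mem_nth.
  pose g i : I := (Ordinal (idx i), top).
  have ginj : injective g.
    move=> i j [/(congr1 (nth o X))].
    have [iL jL] : nth o Ls i \in Ls /\ nth o Ls j \in Ls.
      by split; apply: mem_nth.
    have [[hi _] [hj lj]] := (hX _ iL, hX _ jL).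
    rewrite !nth_index // => e; apply/val_inj/eqP => /=.
    rewrite -(nth_uniq o _ _ uL) //; apply/eqP/esym.
    by apply: hL => //; rewrite e.
  rewrite -[X in (X <= _)%N]card_ord -cardsT -(card_imset _ ginj).
  apply/subset_leq_card/subsetP => _ /imsetP [i _ ->]; rewrite inE /= eqxx andbT.
  have iL : nth o Ls i \in Ls by apply: mem_nth.
  apply/hasP; exists (nth o Ls i) => //; rewrite /pnt /= nth_index //.
  by case: (hX _ iL).
have [Phi PhiE] : exists g : 'Hom(fspace K t, 'rV[K]_(#|~: drop|)),
    forall v, g v = \row_e cond (enum_val e) v.
  apply: linfun_ex => a u v; apply/rowP => e; rewrite !mxE /cond form_lin.
  by rewrite rmorphD rmorphM /chart eval_cst coefsD coefsZ.
have dimker : (\dim {: fspace K t} <= \dim (lker Phi) + #|~: drop|)%N.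
  rewrite -(limg_ker_dim Phi fullv) capfv leq_add2l.
  by apply: leq_trans (dimvS (subvf _)) _; rewrite dimvf /dim /= mul1n.
have cardI : #|I| = (size X * 'C(m.+1, 2))%N by rewrite card_prod card_ord card_tri_idx.
have : (\dim (lker Phi) <= \dim U)%N.
  apply/dimvS/subvP => v; rewrite memv_ker PhiE => /eqP v0; apply: hU.
  have cond0 x j k : x \in X -> (j + k < m)%N -> ~~ (has (fun l => h l == x) Ls && (j == m.-1)) ->
      coefs (chart P (fr x) (form P v)) (t - j - k) j k = 0.
    move=> xX jk nd; have hx : (index x X < size X)%N by rewrite index_mem.
    have [jm km] : (j < m)%N /\ (k < m)%N by lia.
    pose e : I := (Ordinal hx,
      exist (fun x : 'I_m * 'I_m => x.1 + x.2 < m)%N (Ordinal jm, Ordinal km) jk).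
    have eD : e \in ~: drop by rewrite !inE /= /pnt /= nth_index.
    have /rowP /(_ (enum_rank_in eD e)) := v0.
    by rewrite !mxE enum_rankK_in // /cond /= /pnt /= nth_index.
  (* Points without a dropped condition come first: their full multiplicity is used in treating the
     chosen points. *)
  have fat1 x : x \in X -> ~~ has (fun l => h l == x) Ls ->
      ipow (cone_ideal (P := P) x) m (form P v).
    move=> xX nh; have [ep _] := frP x xX; rewrite -{1}ep.
    apply: (ipow_chart (form_homog P v)) => j k jk _.
    by apply: cond0; rewrite // (negPf nh).
  move=> x xX; case: (boolP (has (fun l => h l == x) Ls)) => [|/(fat1 _ xX) //].
  case/hasP => l lL /eqP hl; have [ep /(_ _ lL hl) [lq gq]] := frP x xX.
  have [_ lx] := hX _ lL; rewrite hl in lx.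
  have nl := nL _ lL; set A := fr x in ep lq gq.
  have lp : on_line l (fp A) by rewrite ep.
  set f := line_poly P (fp A) (fq A) (form P v).
  have fE := line_poly_coef A _ (form_homog P v); rewrite -/f in fE.
  (* On [l] the chosen point counts m-1 times, by the conditions kept there, and every other point m
     times. *)
  pose nu y := if y == x then m.-1 else m.
  have div : line_divisor A l X nu %| f.
    apply: (line_divisor_dvd nl pX (form_homog P v)) => // y yX ly; rewrite /nu.
    case: eqP => [->|/eqP yx].
      rewrite /line_coord -[in dot (fb A) x]ep frame_bp mul0r subr0.
      rewrite -/f -(poly_take_drop m.-1 f).
      suff -> : take_poly m.-1 f = 0 by rewrite add0r dvdp_mull.
      apply/polyP => j; rewrite coef_take_poly coef0; case: ltnP => // jm.
      rewrite fE; case: leqP => // _; have := @cond0 x j 0%N xX; rewrite subn0; apply; first lia.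
      by rewrite negb_and; apply/orP; right; rewrite neq_ltn jm.
    apply: (vanish_line_divisor nl (form_homog P v)) => //; first exact: gq.
    (* A point of [l] chosen for a line [l'] forces l' = l, hence is [x]; so the other points of [l]
       keep all their conditions. *)
    apply: ipow_vanish; apply: fat1 => //; apply/hasP => -[l' l'L /eqP hl'].
    by case/eqP: yx; rewrite -hl' -hl (hL _ _ l'L lL) // hl'.
  have sdiv : size (line_divisor A l X nu) = (m * count (on_line l) X)%N.
    have -> : (m * count (on_line l) X = \sum_(y <- X | on_line l y) m)%N.
      by rewrite -sum1_count big_distrr /=; apply: eq_bigr => y _; rewrite muln1.
    rewrite size_line_divisor -[in RHS]big_filter -[in LHS]big_filter; case: pX => uX _ _.
    have xF : x \in [seq y <- X | on_line l y] by rewrite mem_filter lx.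
    rewrite !(bigD1_seq x) ?filter_uniq //= {1}/nu eqxx -addSn prednK //.
    by congr (_ + _)%N; apply: eq_bigr => y /negPf yx; rewrite /nu yx.
  (* The divisor has degree one less than m times the number of points on [l], hence above t. So [f]
     vanishes, and the dropped coefficient is one of its coefficients. *)
  have f0 : f = 0.
    apply/eqP/negPn/negP => fn0; have := dvdp_leq fn0 div.
    have sf : (size f <= t.+1)%N := line_poly_size A (form_homog P v).
    by rewrite leqNgt sdiv (leq_ltn_trans sf (ht _ lL)).
  rewrite -ep; apply: (ipow_chart (form_homog P v)) => j k jk jkt; rewrite -/A.
  case: (eqVneq j m.-1) => [ej|nj]; last by apply: cond0; rewrite // (negPf nj) andbF.
  have k0 : k = 0%N by lia.
  have := fE j; rewrite f0 coef0 k0 subn0; have -> : (j <= t)%N by lia.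
  by move=> <-.
have := cardsC drop; rewrite cardI; move: dimker card_drop; rewrite dim_fspace; lia.
Qed.
End LineRestriction.

(** * Peeling off a sequence of lines *)

Section Peeling.
Variables (K : closedFieldType) (P : poly3 K) (X : seq (pt K)) (ls : nat -> pt K) (m : nat).

(** The multiplicity at [x] of the residual scheme of mX after [j] lines; truncation stops it at
    zero. *)
Definition residual_mult (j : nat) (x : pt K) : nat :=
  (m - \sum_(i < j) on_line (ls i) x)%N.

Lemma residual_multS j x :
  residual_mult j.+1 x = (residual_mult j x - on_line (ls j) x)%N.
Proof. by rewrite /residual_mult big_ord_recr subnDA. Qed.

(** The degree of the residual scheme: a point of multiplicity n contributes C(n+1,2). *)
Definition residual_deg j : nat := (\sum_(x <- X) 'C((residual_mult j x).+1, 2))%N.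

Lemma residual_degS j : residual_deg j =
  (residual_deg j.+1 + \sum_(x <- X | on_line (ls j) x) residual_mult j x)%N.
Proof.
rewrite /residual_deg [X in (_ + X)%N]big_mkcond -big_split; apply: eq_bigr => x _ /=.
rewrite residual_multS; case: (on_line _ _); last by rewrite subn0 addn0.
by case: (residual_mult j x) => [|n]; rewrite ?subn1 //= binS bin1.
Qed.

Definition fits t (U : {vspace fspace K t}) (j : nat) : Prop :=
  forall v, v \in U <-> (forall x, x \in X -> vanish (residual_mult j x) x (form P v)).

(** Call excess the dimension plus the degree of the scheme minus C(t+2,2). A form of degree t-j on
    a line has t-j+1 coefficients; only intersection degree beyond this, at most [e j], can make the
    excess before a step larger than after it. The additive form avoids truncated subtraction. *)
Lemma peel_lines t (e : nat -> nat) (U : {vspace fspace K t}) : proj_set X ->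
  fits U 0 -> forall N t' (U' : {vspace fspace K t'}), t = (t' + N)%N -> fits U' N ->
  (forall j, (j < N)%N -> nonzero_pt (ls j) /\
    (\sum_(x <- X | on_line (ls j) x) residual_mult j x <= (t - j).+1 + e j)%N) ->
  (\dim U + residual_deg 0 + 'C(t'.+2, 2) <=
   'C(t.+2, 2) + \sum_(j < N) e j + (\dim U' + residual_deg N))%N.
Proof.
move=> pX U0; elim=> [|N IH] t' U' et fU' h.
  have et' : t = t' by rewrite et addn0.
  subst t'; have -> : U' = U.
    by apply/vspaceP => v; apply/idP/idP => [/fU'|/U0]; [move/U0 | move/fU'].
  by rewrite big_ord0; lia.
have [U1 fU1] := vanish_space_ex P X (residual_mult N) t'.+1.
have et1 : t = (t'.+1 + N)%N by rewrite et addSnnS.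
have {}IH := IH _ U1 et1 fU1 (fun j hj => h j (ltnW hj)).
have [nl hs] := h N (ltnSn N); rewrite et1 addnK in hs.
have fU2 v : v \in U' <-> (forall x, x \in X ->
    vanish (residual_mult N x - on_line (ls N) x) x (form P v)).
  by rewrite fU'; split=> hv x xX; have := hv _ xX; rewrite residual_multS.
have := peel_line nl pX fU1 fU2; rewrite big_ord_recr /=.
move: IH hs; rewrite (residual_degS N) [in 'C(t'.+3, 2)]binS bin1.
move: (\sum_(x <- X | _) _)%N (\sum_(i < N) _)%N => S E.
move: (\dim U) (\dim U1) (\dim U') (residual_deg 0) (residual_deg N.+1) => a b c r0 r1.
move: 'C(_, _) 'C(_, _) (e N) => q1 q2 eN; lia.
Qed.
End Peeling.

(** * Finite sets of pairwise non-proportional triples *)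

Section ProjectiveSets.
Variable K : closedFieldType.
Implicit Types (l x : pt K) (X : seq (pt K)).

Lemma proj_set_sub X Y : uniq Y -> {subset Y <= X} -> proj_set X -> proj_set Y.
Proof.
move=> uY sub [_ nX iX]; split=> // [x /sub /nX //|x y /sub xX /sub yX].
exact: iX.
Qed.

Lemma proj_list_set X : proj_list X -> proj_set X.
Proof.
move=> [nX h]; have inj i j : (i < size X)%N -> (j < size X)%N ->
    proj_eq (nth (0, 0, 0) X i) (nth (0, 0, 0) X j) -> i = j.
  by move=> hi hj e; apply: contraTeq e => /eqP /(h _ _ hi hj).
split=> // [|x y /(nthP (0, 0, 0)) [i hi <-] /(nthP (0, 0, 0)) [j hj <-] /inj -> //].
apply/(uniqP (0, 0, 0)) => i j hi hj e; apply: inj => //; rewrite e; exact: proj_eq_refl.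
Qed.

Lemma proj_set_leq_size (A B : seq (pt K)) : proj_set A ->
  (forall b, b \in B -> nonzero_pt b) ->
  (forall a, a \in A -> exists2 b, b \in B & proj_eq a b) -> (size A <= size B)%N.
Proof.
move=> [uA nA iA] nB AB; pose f a := nth (0, 0, 0) B (find (proj_eq a) B).
have hasB a : a \in A -> has (proj_eq a) B by case/AB => b bB ab; apply/hasP; exists b.
have fB a : a \in A -> f a \in B by move/hasB; rewrite has_find; apply: mem_nth.
have fa a : a \in A -> proj_eq a (f a) by move/hasB; apply: nth_find.
rewrite -(size_map f A); apply: uniq_leq_size => [|_ /mapP [a aA ->]]; last exact: fB.
rewrite map_inj_in_uniq // => a a' aA a'A e; apply: iA => //.
apply: (@proj_eq_trans _ (f a)); [exact/nB/fB | exact: fa | rewrite e proj_eq_sym; exact: fa].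
Qed.

Lemma count_two_lines l l' X : proj_set X -> nonzero_pt l -> nonzero_pt l' ->
  ~~ proj_eq l l' -> (count (fun x => on_line l x && on_line l' x) X <= 1)%N.
Proof.
move=> [uX nX iX] nl nl' nll; rewrite -size_filter leqNgt; apply: contra nll => lt.
set F := filter _ X in lt; have uF : uniq F by exact: filter_uniq.
pose p := nth (0, 0, 0) F 0; pose q := nth (0, 0, 0) F 1.
have : p \in F /\ q \in F by split; apply: mem_nth => //; apply: ltn_trans lt.
rewrite !mem_filter => -[/andP [/andP [lp lp'] pX] /andP [/andP [lq lq'] qX]].
apply: (two_points_line nl nl' _ lp lq lp' lq'); apply/negP => /iX e.
by have := nth_uniq (0, 0, 0) (ltn_trans (ltnSn 0) lt) lt uF; rewrite -/p -/q e // eqxx.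
Qed.
End ProjectiveSets.

(** Counts the visits to position [b] of a cyclic order: one per completed round, and one more if
    the current round has passed it. *)
Lemma sum_mod_eq s b j : (b < s)%N ->
  (\sum_(i < j) (i %% s == b) = j %/ s + (b < j %% s))%N.
Proof.
move=> bs; have s0 : (0 < s)%N by apply: leq_ltn_trans bs.
elim: j => [|j IH]; first by rewrite big_ord0 div0n mod0n ltn0.
rewrite big_ord_recr IH /=; have cs := ltn_pmod j s0.
rewrite (_ : j.+1 = j %/ s * s + (j %% s).+1)%N; last by rewrite addnS -divn_eq.
move: (j %/ s)%N (j %% s)%N cs => k c cs.
case: (ltngtP c.+1 s) cs => // [cs _|cs _].
  rewrite divnMDl // divn_small // modnMDl modn_small // addn0.
  by rewrite -addnA; congr (_ + _)%N; case: ltngtP; lia.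
rewrite cs -mulSnr mulnK // modnMl ltn0 addn0.
by case: ltngtP; lia.
Qed.

Lemma card_gt_ord i n : (\sum_(j < n | i < j) 1 = n - i.+1)%N.
Proof.
elim: n => [|n IH]; first by rewrite big_ord0.
by rewrite big_mkcond big_ord_recr -big_mkcond IH /=; case: ltnP; lia.
Qed.

Lemma sum_le_count (T : eqType) (Z : seq T) (Q : pred T) (f : T -> nat) a :
  (forall z, z \in Z -> (f z <= a)%N) -> (\sum_(z <- Z | Q z) f z <= a * count Q Z)%N.
Proof.
move=> h; rewrite -sum1_count big_distrr /= big_seq_cond [X in (_ <= X)%N]big_seq_cond.
by apply: leq_sum => z /andP [zZ _]; rewrite muln1 h.
Qed.

(** * Blocks, lines and peeling order of a configuration *)

Section Configuration.
Variables (K : closedFieldType) (X : seq (pt K)) (ds : seq nat).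
Variables (Xs : seq (seq (pt K))) (LL : seq (pt K)).
Notation s := (size ds).
Notation d := (last 0%N ds).
Notation o := ((0, 0, 0) : pt K).
Notation Y := (nth [::] Xs).
Notation L := (nth o LL).
Notation D := (nth 0%N ds).
Hypothesis pX : proj_set X.
Hypothesis pLL : proj_set LL.
Hypothesis sLL : size LL = s.
Hypothesis ds_sorted : sorted ltn ds.
Hypothesis blocks : forall i, (i < s)%N ->
  [/\ uniq (Y i), size (Y i) = D i, {subset Y i <= X}
    & forall p, p \in Y i -> on_line (L i) p].
Hypothesis avoid : forall i j, (j < i)%N -> (i < s)%N ->
  forall p, p \in Y j -> ~~ on_line (L i) p.
Hypothesis cover : forall p, p \in X -> exists2 i, (i < s)%N & p \in Y i.

Lemma line_nonzero i : (i < s)%N -> nonzero_pt (L i).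
Proof. by case: pLL => _ nL _ hi; apply/nL/mem_nth; rewrite sLL. Qed.

Lemma lines_distinct i j : (i < s)%N -> (j < s)%N -> i != j -> ~~ proj_eq (L i) (L j).
Proof.
move=> hi hj; apply: contra => e; case: pLL => uL _ iL.
have [Li Lj] : L i \in LL /\ L j \in LL by rewrite !mem_nth // sLL.
by rewrite -(nth_uniq o _ _ uL) ?sLL //; apply/eqP; apply: iL.
Qed.

(** A common point would lie on the later of the two lines, which avoids the earlier block. Hence
    the blocks partition [X]. *)
Lemma block_index_uniq i j p : (i < s)%N -> (j < s)%N -> p \in Y i -> p \in Y j -> i = j.
Proof.
move=> hi hj pi pj; case: (ltngtP i j) => // lt.
  by have := avoid lt hj pi; have [_ _ _ ->] := blocks hj.
by have := avoid lt hi pj; have [_ _ _ ->] := blocks hi.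
Qed.

Lemma sum_blocks (Q : pred (pt K)) (f : pt K -> nat) :
  (\sum_(p <- X | Q p) f p = \sum_(i < s) \sum_(p <- Y i | Q p) f p)%N.
Proof.
have e (i : 'I_s) : (\sum_(p <- Y i | Q p) f p =
    \sum_(p <- X) if (p \in Y i) && Q p then f p else 0)%N.
  have [uY _ YX _] := blocks (ltn_ord i).
  rewrite -big_mkcond -big_filter_cond; apply: perm_big; apply: uniq_perm => //.
    by case: pX => uX _ _; apply: filter_uniq.
  by move=> p; rewrite mem_filter; case: (boolP (p \in Y i)) => // /YX ->.
rewrite (eq_bigr _ (fun i _ => e i)) exchange_big /= big_mkcond.
apply: eq_big_seq => p /cover [i hi pi].
rewrite (bigD1 (Ordinal hi)) //= pi big1 ?addn0 // => j ji.
case: ifP => // /andP [pj _]; case/eqP: ji; apply: val_inj.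
exact: block_index_uniq (ltn_ord j) hi pj pi.
Qed.

Lemma count_blocks (Q : pred (pt K)) : count Q X = (\sum_(i < s) count Q (Y i))%N.
Proof.
by rewrite -sum1_count sum_blocks; apply: eq_bigr => i _; rewrite sum1_count.
Qed.

Lemma count_block_le l i : nonzero_pt l -> (i < s)%N -> ~~ proj_eq l (L i) ->
  (count (on_line l) (Y i) <= 1)%N.
Proof.
move=> nl hi nli; have [uY _ YX YL] := blocks hi.
have := count_two_lines (proj_set_sub uY YX pX) nl (line_nonzero hi) nli.
by rewrite (@eq_in_count _ _ (on_line l)) // => p /YL ->; rewrite andbT.
Qed.

(** Each block lies on a line different from [l] and so has at most one point on [l]. *)
Lemma count_other_line l : nonzero_pt l -> (forall i, (i < s)%N -> ~~ proj_eq l (L i)) ->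
  (count (on_line l) X <= s)%N.
Proof.
move=> nl h; rewrite count_blocks -[X in (_ <= X)%N]card_ord -sum1_card.
by apply: leq_sum => i _; apply: count_block_le => //; apply: h.
Qed.

(** The type increases strictly, so each of the s-1-i steps up to the last entry gains at least
    one. *)
Lemma block_size i : (i < s)%N -> (D i + (s.-1 - i) <= d)%N.
Proof.
move=> hi; rewrite -nth_last.
suff H c : (i + c < s)%N -> (D i + c <= D (i + c))%N.
  by have := H (s.-1 - i)%N; rewrite subnKC; [apply; lia | lia].
elim: c => [|c IH] hc; first by rewrite !addn0.
rewrite !addnS; apply: leq_ltn_trans (IH _) _; first by lia.
by apply: (sorted_ltn_nth ltn_trans 0%N ds_sorted) => //; rewrite inE; lia.
Qed.

(* The blocks met by line i are block i, contained in it, and each later block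
   in at most one point. *)
Lemma count_line_excess i : (i < s)%N ->
  exists2 E, count (on_line (L i)) X = (D i + E)%N & (E <= s.-1 - i)%N /\
  forall a (mu : pt K -> nat), (forall p, p \in Y i -> (mu p <= a)%N) ->
    (forall j p, (i < j < s)%N -> p \in Y j -> (mu p <= a.-1)%N) ->
    (\sum_(p <- X | on_line (L i) p) mu p <= a * D i + a.-1 * E)%N.
Proof.
move=> hi; pose c j := count (on_line (L i)) (Y j).
have [uY sY _ YL] := blocks hi.
have ci : c i = D i by rewrite -sY -count_predT; apply: eq_in_count => p /YL ->.
have clt j : (j < i)%N -> c j = 0%N.
  move=> ji; apply/eqP; rewrite -leqn0 leqNgt -has_count; apply/hasP => -[p pj].
  by apply/negP; apply: avoid pj.
have cgt j : (i < j < s)%N -> (c j <= 1)%N.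
  case/andP=> ij js; apply: count_block_le => //; first exact: line_nonzero.
  by apply: lines_distinct => //; rewrite neq_ltn ij.
exists (\sum_(j < s | j != Ordinal hi) c j)%N; last split.
- by rewrite count_blocks (bigD1 (Ordinal hi)) //= -/(c i) ci.
- rewrite (bigID (fun j : 'I_s => i < j)%N) /= [X in (_ + X)%N]big1 ?addn0 => [|j]; last first.
    by rewrite -val_eqE /= -leqNgt => /andP [ni ij]; apply: clt; rewrite ltn_neqAle ni.
  apply: leq_trans (_ : (\sum_(j < s | (i < j)%N) 1 <= _)%N).
    rewrite big_mkcond [X in (_ <= X)%N]big_mkcond; apply: leq_sum => j _.
    case: ltnP => ij; rewrite ?andbF // ?andbT; case: ifP => // _.
    by apply: cgt; rewrite ij ltn_ord.
  by rewrite card_gt_ord; lia.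
move=> a mu h1 h2; rewrite sum_blocks (bigD1 (Ordinal hi)) //=; apply: leq_add.
  by rewrite -ci; apply: sum_le_count.
rewrite big_distrr; apply: leq_sum => j; rewrite -val_eqE /= => ji.
case: (ltngtP j i) ji => // ij _; last first.
  by apply: sum_le_count => p; apply: h2; rewrite ij ltn_ord.
rewrite big_seq_cond big1 // => p /andP [pj li]; case/negP: (avoid ij hi pj).
exact: li.
Qed.

(* Lines are indexed from 0, so this runs cyclically through L_s, ..., L_1. *)
Definition peel_order j := L (s.-1 - j %% s).
Notation mult := (residual_mult peel_order).

(** Only visits to the line of the point's own block are counted; that line has position s-1-b in
    every round. *)
Lemma peel_visits b j p : (b < s)%N -> p \in Y b ->
  (j %/ s + (s.-1 - b < j %% s) <= \sum_(i < j) on_line (peel_order i) p)%N.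
Proof.
move=> bs pb; have bs' : (s.-1 - b < s)%N by lia.
rewrite -(sum_mod_eq j bs'); apply: leq_sum => i _; case: eqP => // ei.
rewrite /peel_order ei; have -> : (s.-1 - (s.-1 - b))%N = b by lia.
by have [_ _ _ ->] := blocks bs.
Qed.

Hypothesis s_lt_d : (s < d)%N.

(** The defect allowed at step [j] in degree md-2; the condition [j < s] confines it to round 0. *)
Definition full_line j : bool :=
  (j < s)%N && (count (on_line (L (s.-1 - j))) X == d).

(** The first bound gives defect zero in degree md-1, the second defect [full_line j] in degree
    md-2. With j = k s + c, the intersection degree is at most (m-k) d - c, and k s <= k d. *)
Lemma peel_bound m j : (1 < m)%N -> (j < m * s)%N ->
  (\sum_(p <- X | on_line (peel_order j) p) mult m j p + j <= m * d
   /\ \sum_(p <- X | on_line (peel_order j) p) mult m j p + j < m * d + full_line j)%N.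
Proof.
move=> m1 jms; have s0 : (0 < s)%N by case: (s) jms; rewrite ?muln0.
have cs := ltn_pmod j s0; have ej := divn_eq j s.
have km : (j %/ s < m)%N by rewrite ltn_divLR.
pose c := (j %% s)%N; pose k := (j %/ s)%N; pose i := (s.-1 - c)%N.
have hi : (i < s)%N by rewrite /i; lia.
have [E eE [Ec bound]] := count_line_excess hi.
have hD := block_size hi; have ci : (s.-1 - i)%N = c by rewrite /i; lia.
rewrite ci in Ec hD.
(* Own points have been peeled at least k times; points of later blocks at least k+1 times, their
   line having been passed in this round too. *)
have S : (\sum_(p <- X | on_line (peel_order j) p) mult m j p
    <= (m - k) * D i + (m - k).-1 * E)%N.
  apply: bound => [p pi|b p /andP [ib bs] pb].
    apply: leq_sub2l; apply: leq_trans (peel_visits j hi pi); exact: leq_addr.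
  rewrite -subnS; apply: leq_sub2l; apply: leq_trans (peel_visits j bs pb).
  have -> : (s.-1 - b < j %% s)%N by rewrite -/c; move: ib; rewrite /i; lia.
  by rewrite addn1.
have fE : full_line j = (k == 0)%N && (D i + E == d)%N.
  rewrite /full_line -eE; case: ltnP => js.
    by rewrite /k divn_small // eqxx /i /c modn_small.
  by rewrite /k (_ : (j %/ s == 0)%N = false) //; apply/negbTE; rewrite -lt0n divn_gt0.
move: S; rewrite fE; move: (\sum_(p <- X | _) _)%N => S.
rewrite -/k -/c in ej km cs.
have [b mb] : exists b, m = (k + b.+1)%N by exists (m - k).-1; lia.
have -> : (m - k)%N = b.+1 by lia.
clear bound fE eE hi ci; clearbody i k c.
move: ej km cs hD Ec s_lt_d m1; rewrite mb /= => ->.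
move: (D i) (last _ _) (size ds) => x y z km cz hD Ec zy m1 hS.
have h1 : (b.+1 * (x + c) <= b.+1 * y)%N by rewrite leq_mul2l hD orbT.
have h2 : (b * E <= b * c)%N by rewrite leq_mul2l Ec orbT.
have h3 : (k * z <= k * y)%N by rewrite leq_mul2l ltnW ?orbT.
have main : (S + c <= b.+1 * y)%N.
  apply: leq_trans h1; rewrite mulnDr; move: hS h2; rewrite mulSn [(b.+1 * c)%N]mulSn; lia.
rewrite mulnDl; split; first by lia.
(* Strictness: for k > 0 it comes from s < d. For k = 0 and a line without d points, either its
   block is smaller than d - c or it meets fewer than c later points; the latter suffices because
   m-1 > 0. *)
case: (posnP k) => [k0|kp]; last first.
  have h4 : (k * z < k * y)%N by rewrite ltn_pmul2l.
  by lia.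
rewrite k0 !mul0n !add0n /=; case: eqP => [_|ne]; first by rewrite addn1.
have bp : (0 < b)%N by rewrite k0 in m1.
rewrite addn0; case: (ltnP (x + c) y) => [lt|ge].
  have h5 : (b.+1 * (x + c) < b.+1 * y)%N by rewrite ltn_pmul2l.
  apply: leq_ltn_trans h5; rewrite mulnDr; move: hS h2; rewrite mulSn [(b.+1 * c)%N]mulSn; lia.
have h6 : (b * E < b * c)%N by rewrite ltn_pmul2l //; lia.
apply: leq_trans h1; rewrite mulnDr; move: hS h6; rewrite mulSn [(b.+1 * c)%N]mulSn; lia.
Qed.

(** In m rounds the line of the point's own block is peeled m times. *)
Lemma residual_mult_end m p : p \in X -> mult m (m * s) p = 0%N.
Proof.
case/cover => b bs pb; apply/eqP; rewrite subn_eq0.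
apply: leq_trans (peel_visits (m * s) bs pb).
by rewrite mulnK ?leq_addr //; apply: leq_ltn_trans bs.
Qed.

Lemma sum_full_line m : (0 < m)%N ->
  (\sum_(j < m * s) full_line j = size [seq l <- LL | count (on_line l) X == d])%N.
Proof.
case: m => // m _; rewrite mulSn big_split_ord /= [X in (_ + X)%N]big1 ?addn0; last first.
  by move=> j _; rewrite /full_line ltnNge leq_addr.
rewrite size_filter -sum1_count (big_nth o) sLL big_mkord [RHS]big_mkcond /=.
rewrite (reindex_inj rev_ord_inj) /=; apply: eq_bigr => j _.
rewrite /full_line; have hj := ltn_ord j.
have -> : (s - j.+1 < s)%N by lia.
have -> : (s.-1 - (s - j.+1))%N = j by lia.
by case: (_ == _).
Qed.

(** A line with d > s points must be one of the [L i], by [count_other_line]; this bounds [Ls] by s.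
    Conversely [Ls] represents every line with d points. *)
Lemma full_lines_leq Ls : lines_with_exactly X d Ls ->
  (size [seq l <- LL | count (on_line l) X == d] <= size Ls)%N /\ (size Ls <= s)%N.
Proof.
case=> /proj_list_set pLs [cLs allLs]; have [uL nL iL] := pLL; have [uS nS iS] := pLs.
split.
  apply: (proj_set_leq_size _ nS) => [|l]; last first.
    by rewrite mem_filter => /andP [/eqP cl lL]; apply: allLs => //; apply: nL.
  apply: proj_set_sub pLL; first exact: filter_uniq.
  by move=> l; rewrite mem_filter => /andP [].
rewrite -sLL; apply: (proj_set_leq_size pLs nL) => l lL.
case: (boolP (has (proj_eq l) LL)) => [/hasP [l' ? ?]|/hasPn h]; first by exists l'.
have := count_other_line (nS _ lL); rewrite (cLs _ lL) leqNgt s_lt_d => ch.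
have /ch // : forall i, (i < s)%N -> ~~ proj_eq l (L i).
by move=> i hi; apply/h/mem_nth; rewrite sLL.
Qed.

(* A line with d > s points has a point on no other such line, as there are at
   most s of them. *)
Lemma private_point Ls : lines_with_exactly X d Ls -> exists h : pt K -> pt K,
  (forall l, l \in Ls -> h l \in X /\ on_line l (h l)) /\
  {in Ls &, forall l l', on_line l' (h l) -> l' = l}.
Proof.
move=> hLs; have [_ rs] := full_lines_leq hLs.
case: hLs => /proj_list_set pLs [cLs _]; have [uS nS iS] := pLs.
pose Q l x := on_line l x && all (fun l' => (l' == l) || ~~ on_line l' x) Ls.
have ex l : l \in Ls -> has (Q l) X.
  move=> lL; apply/negPn/negP => /hasPn no.
  (* Otherwise each of the d points of [l] lies on another line of [Ls], while each such line meets
     [l] in at most one point of [X]. *)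
  suff : (d <= size (rem l Ls))%N.
    rewrite size_rem // leqNgt => /negP; apply.
    by apply: leq_ltn_trans (leq_pred _) _; apply: leq_ltn_trans rs s_lt_d.
  rewrite -(cLs _ lL) -sum1_count -(sum1_size (rem l Ls)).
  apply: leq_trans (_ : \sum_(x <- X | on_line l x) \sum_(l' <- rem l Ls) on_line l' x <= _)%N.
    rewrite big_seq_cond [X in (_ <= X)%N]big_seq_cond; apply: leq_sum => x /andP [xX lx].
    have := no _ xX; rewrite /Q lx /= -has_predC => /hasP [l' l'L /=].
    rewrite negb_or negbK => /andP [ne l'x].
    by rewrite (bigD1_seq l') ?rem_uniq //= ?l'x // mem_rem_uniq // inE ne.
  rewrite exchange_big /= big_seq [X in (_ <= X)%N]big_seq; apply: leq_sum => l'.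
  rewrite mem_rem_uniq // inE => /andP [ne l'L].
  have nll : ~~ proj_eq l l' by apply: contra ne => /iS e; rewrite e.
  have := count_two_lines pX (nS _ lL) (nS _ l'L) nll.
  apply: leq_trans; rewrite -sum1_count big_mkcondr.
  by apply: leq_sum => x _; case: (on_line l' x).
exists (fun l => nth o X (find (Q l) X)); split=> [l /ex hl|l l' lL l'L].
  have /andP [? _] := nth_find o hl; split=> //; by apply: mem_nth; rewrite -has_find.
have /andP [_ /allP /(_ _ l'L) /orP [/eqP //|/negP h /h //]] := nth_find o (ex _ lL).
Qed.
End Configuration.

(** * Hilbert functions through spaces of coefficient vectors *)

Section Hilbert.
Variable K : closedFieldType.
Implicit Types (X : seq (pt K)) (F : R3 K).
Notation P := (R3_poly3 K).

Lemma I_ptE p F : I_pt p F <-> cone_ideal (P := P) p F.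
Proof. by split=> h c; have := h c; rewrite eval3_ev. Qed.

Lemma ideal_powE p m F : ideal_pow (I_pt p) m F <-> ipow (cone_ideal (P := P) p) m F.
Proof.
by split=> -[n [g [h [gI eF]]]]; exists n, g, h; split=> // i j; apply/I_ptE.
Qed.

(** [has_dim] holds for [\dim U] and for at most one number, so the choice made by [epsilon] is the
    true dimension. *)
Lemma dimK_vspace t (S : R3 K -> Prop) (U : {vspace fspace K t}) :
  (forall F, S F -> homog t F) -> (forall v, v \in U <-> S (form P v)) ->
  dimK S = \dim U.
Proof.
move=> Sh US; have h : has_dim S (\dim U) := @has_dim3_vspace K P t S U Sh US.
have h' := epsilon_spec (inhabits 0%N) (has_dim S) (ex_intro _ _ h).
exact: (@has_dim3_uniq K P S _ _ h' h).
Qed.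

Lemma dimK_homog t : dimK (@homog K t) = 'C(t.+2, 2).
Proof.
rewrite (@dimK_vspace t _ fullv) ?dim_fspace // => v.
by rewrite memvf; split=> // _; exact: (form_homog P v).
Qed.

Lemma fat_space_ex X m t : exists U : {vspace fspace K t},
  forall v, v \in U <-> (forall x, x \in X -> ipow (cone_ideal (P := P) x) m (form P v)).
Proof.
apply: subspace_ex => [x _|a u v hu hv x xX]; first by rewrite form0; apply: ipow0.
by rewrite form_lin; apply: ipowD; [apply/ipowMl/hu | apply: hv].
Qed.

Lemma hilb_fat X m t (U : {vspace fspace K t}) :
  (forall v, v \in U <-> (forall x, x \in X -> ipow (cone_ideal (P := P) x) m (form P v))) ->
  hilb (I_fat X m) t = ('C(t.+2, 2))%:Z - (\dim U)%:Z.
Proof.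
move=> hU; rewrite /hilb dimK_homog (@dimK_vspace t _ U) // => [F []//|v].
split=> [/hU vU|[_ vU]].
  by split; [exact: (form_homog P v) | move=> x xX; apply/ideal_powE/vU].
by apply/hU => x xX; apply/ideal_powE/vU.
Qed.
End Hilbert.

(** Peeling ends with an empty scheme: the last space has dimension at most the number of monomials
    of degree t-N, so no positive excess remains. *)
Lemma fat_dim_le (K : closedFieldType) (X : seq (pt K)) (ls : nat -> pt K) m t N
    (e : nat -> nat) (U : {vspace fspace K t}) :
  proj_set X -> (N <= t)%N ->
  (forall v, v \in U <-> (forall x, x \in X ->
     ipow (cone_ideal (P := R3_poly3 K) x) m (form (R3_poly3 K) v))) ->
  (forall x, x \in X -> residual_mult ls m N x = 0%N) ->
  (forall j, (j < N)%N -> nonzero_pt (ls j) /\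
    (\sum_(x <- X | on_line (ls j) x) residual_mult ls m j x <= (t - j).+1 + e j)%N) ->
  (\dim U + size X * 'C(m.+1, 2) <= 'C(t.+2, 2) + \sum_(j < N) e j)%N.
Proof.
move=> pX Nt hU endX h.
have [U0 fU0] := vanish_space_ex (R3_poly3 K) X (residual_mult ls m 0) t.
have [U1 fU1] := vanish_space_ex (R3_poly3 K) X (residual_mult ls m N) (t - N).
have et : t = (t - N + N)%N by rewrite subnK.
have := peel_lines pX fU0 et fU1 h.
have le0 : (\dim U <= \dim U0)%N.
  apply/dimvS/subvP => v /hU vU; apply/fU0 => x xX; rewrite /residual_mult big_ord0 subn0.
  exact/ipow_vanish/vU.
have le1 : (\dim U1 <= 'C((t - N).+2, 2))%N by rewrite -(dim_fspace K) dimvS ?subvf.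
have -> : residual_deg X ls m 0 = (size X * 'C(m.+1, 2))%N.
  rewrite /residual_deg; under eq_bigr do rewrite /residual_mult big_ord0 subn0.
  by rewrite big_const_seq count_predT iter_addn_0 mulnC.
have -> : residual_deg X ls m N = 0%N.
  by rewrite /residual_deg big_seq big1 // => x /endX ->.
by rewrite addn0; move: le0 le1; lia.
Qed.

Local Close Scope ring_scope.

Theorem theorem3p1 (K : closedFieldType) (X : seq (pt K)) (ds : seq nat)
    (Ls : seq (pt K)) :
  kconfig X ds ->
  (size ds < last 0 ds)%N ->
  lines_with_exactly X (last 0 ds) Ls ->
  forall m : nat, (2 <= m)%N ->
    ((size Ls)%:Z = deltaH (I_fat X m) (m * last 0%N ds - 1)%N)%R.
Proof.
move=> [/proj_list_set pX [_ [_ [srt [Xs [LL [hLL [blk avd cov]]]]]]]] sd hLs m m2.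
have [_ sLL /proj_list_set pLL] := hLL.
clear hLL; set s := size ds in sLL blk avd cov sd; set d := last 0%N ds in sd hLs *.
have [h [hX hL]] := private_point pX pLL sLL blk avd cov sd hLs.
have [rd _] := full_lines_leq pX pLL sLL blk avd cov sd hLs.
have [/proj_list_set [uLs nLs _] [cLs _]] := hLs.
(* [n] is the lower of the two degrees. As s < d and m >= 2, it is at least m s, which leaves room
   for all the peelings. *)
pose n := (m * d - 2)%N; have md : (m * s + 2 <= m * d)%N by nia.
have -> : (m * d - 1)%N = n.+1 by rewrite /n; lia.
have [U1 hU1] := fat_space_ex X m n.+1; have [U0 hU0] := fat_space_ex X m n.
rewrite /deltaH (hilb_fat hU1) (hilb_fat hU0).
have nz j : (j < m * s)%N -> nonzero_pt (peel_order ds LL j).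
  move=> hj; apply: (line_nonzero pLL sLL); rewrite -/s.
  by case: (s) hj => [|k] hj; [rewrite muln0 in hj | lia].
have endX := residual_mult_end sLL srt blk cov m.
have bnd := peel_bound pX pLL sLL srt blk avd cov sd m2.
have hi1 := @fat_dim_le K X (peel_order ds LL) m n.+1 (m * s) (fun _ => 0%N) U1 pX.
have hi0 := @fat_dim_le K X (peel_order ds LL) m n (m * s) (full_line X ds LL) U0 pX.
have {}hi1 : (\dim U1 + size X * 'C(m.+1, 2) <= 'C(n.+3, 2))%N.
  have -> : 'C(n.+3, 2) = ('C(n.+3, 2) + \sum_(j < m * s) 0)%N by rewrite big1 ?addn0.
  apply: hi1 => [||x|j hj] //; first by rewrite /n; lia.
    exact: endX.
  by split; [exact: nz | have [+ _] := bnd j hj; rewrite /n -/d; lia].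
have {}hi0 : (\dim U0 + size X * 'C(m.+1, 2) <= 'C(n.+2, 2) + size Ls)%N.
  apply: leq_trans (_ : 'C(n.+2, 2) + \sum_(j < m * s) full_line X ds LL j <= _)%N.
    apply: hi0 => [||x|j hj] //; first by rewrite /n; lia.
      exact: endX.
    by split; [exact: nz | have [_ +] := bnd j hj; rewrite /n -/d; lia].
  by rewrite leq_add2l (sum_full_line X sLL srt sd) // ltnW.
have m0 : (0 < m)%N by exact: ltnW.
(* With no lines given, this is the plain count of linear conditions. *)
have lo1 : ('C(n.+3, 2) <= \dim U1 + size X * 'C(m.+1, 2))%N.
  have := @fat_dim_ge K (R3_poly3 K) X m n.+1 [::] id U1 m0 pX.
  by rewrite addn0; apply=> // v /hU1.
have lo0 : ('C(n.+2, 2) + size Ls <= \dim U0 + size X * 'C(m.+1, 2))%N.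
  apply: (@fat_dim_ge K (R3_poly3 K) X m n Ls h U0 m0 pX) => // [l lL|v /hU0 //].
  by rewrite cLs // /n; lia.
(* Both dimensions are now exact: with q the degree of mX, the Hilbert function is q in degree md-1
   and q - r in degree md-2. *)
move: hi0 hi1 lo0 lo1; move: (\dim U0) (\dim U1) (size Ls) (size X * _)%N => a b r q.
move: 'C(_, _) 'C(_, _) => c c'; lia.
Qed.
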